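(* Every $7$-dimensional indecomposable $2$-step nilpotent real Lie algebra admits a purely coclosed $\mathrm{G}_2$-structure, except for the Lie algebras (up to isomorphism) $27A$ and $27B$, which do not admit one. Here $$27A=(0,0,0,0,0,12,14+35),\qquad 27B=(0,0,0,0,0,12+34,15+23).$$
   Context: All Lie algebras are real and finite-dimensional. A Lie algebra is indecomposable if it is not a direct sum of two non-zero ideals. Notation such as $(0,0,0,0,0,12,14+35)$ denotes the $7$-dimensional Lie algebra $\mathfrak g$ having a basis whose dual basis $e^1,\dots,e^7$ satisfies $de^1,\dots,de^7$ equal to the listed entries, where $ij$ stands for $e^{ij}=e^i\wedge e^j$ (in the example, $de^1=\dots=de^5=0$, $de^6=e^{12}$, $de^7=e^{14}+e^{35}$), and $d$ is the Chevalley–Eilenberg differential on $\Lambda^*(\mathfrak{g}^* )$, i.e. the derivation dual to the bracket. Let $\mathfrak{g}$ be a $7$-dimensional Lie algebra. A $\mathrm{G}_2$-structure on $\mathfrak g$ is a positive $3$-form $\varphi\in\Lambda^3(\mathfrak{g}^* )$, i.e. one for which there is a basis $e_1,\dots,e_7$ of $\mathfrak{g}$ with dual basis $e^1,\dots,e^7$ such that $$\varphi=e^{127}+e^{347}+e^{567}+e^{135}-e^{146}-e^{236}-e^{245}.$$ Such a $\varphi$ determines a unique inner product $g_\varphi$ and orientation on $\mathfrak g$, for which $e_1,\dots,e_7$ is an oriented orthonormal basis; $*_\varphi$ is the corresponding Hodge star, so that $*_\varphi\varphi=e^{1234}+e^{1256}+e^{1367}+e^{1457}+e^{2357}-e^{2467}+e^{3456}$.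 The $\mathrm{G}_2$-structure is coclosed if $d*_\varphi\varphi=0$, and purely coclosed if $d*_\varphi\varphi=0$ and $\varphi\wedge d\varphi=0$. *)

(* Defs.v *)
From HB Require Import structures.
From mathcomp Require Import all_boot all_order all_fingroup all_algebra.
From mathcomp Require Import boolp classical_sets functions reals.

Set Implicit Arguments.
Unset Strict Implicit.
Unset Printing Implicit Defensive.

Import Order.TTheory GRing.Theory Num.Theory.
Local Open Scope ring_scope.

HB.mixin Record isLieAlgebra (R : realType) V of GRing.Lmodule R V := {
  lie : V -> V -> V;
  lie_linearl : forall z, linear (fun x => lie x z);
  lie_linearr : forall x, linear (lie x);
  liexx : forall x, lie x x = 0;
  lie_jacobi : forall x y z,
    lie x (lie y z) + lie y (lie z x) + lie z (lie x y) = 0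
}.

(* Being a vectType, a Lie algebra is finite-dimensional. *)
#[short(type="lieAlgebraType")]
HB.structure Definition LieAlgebra (R : realType) :=
  { V of isLieAlgebra R V & Vector R V }.

Section LieAlgebras.
Variables (R : realType) (g : lieAlgebraType R).

Definition is_ideal (I : {vspace g}) : Prop :=
  forall x y : g, y \in I -> lie x y \in I.

Definition indecomposable : Prop :=
  ~ exists I J : {vspace g},
      [/\ is_ideal I, is_ideal J, I != 0%VS, J != 0%VS &
          (I + J)%VS = fullv /\ (I :&: J)%VS = 0%VS].

Definition two_step_nilpotent : Prop :=
  (exists x y : g, lie x y <> 0) /\
  (forall x y z : g, lie x (lie y z) = 0).

End LieAlgebras.

(* A k-form on g is represented by its values on k-tuples of vectors; sums and
   opposites of forms are the pointwise ones.  This type does not enforce that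
   a form is multilinear and alternating, but all the forms below are built
   from covectors by linear combinations, wedge, d and the Hodge star, and
   these operations preserve that property. *)

Section Forms.
Variables (R : realType) (g : lieAlgebraType R).
Local Notation form k := (('I_k -> g) -> R).

(* The normalization for which
   (a_1 /\ ... /\ a_k) (v_1, ..., v_k) = \det (a_i v_j) for covectors a_i. *)
Definition wedge (p q : nat) (a : form p) (b : form q) : form (p + q) :=
  fun v => (p`! * q`!)%N%:R^-1 *
    \sum_(s : 'S_(p + q)) (-1) ^+ s *
      (a (fun i => v (s (lshift q i))) * b (fun j => v (s (rshift p j)))).

Definition vcons (k : nat) (x : g) (v : 'I_k -> g) : 'I_k.+1 -> g :=
  fun a => if unlift ord0 a is Some b then v b else x.

(* The Chevalley-Eilenberg differential in positive degree:
     (d a) (v_0, ..., v_k) =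
       \sum_(i < j) (-1)^(i + j) a ([v_i, v_j], v_0, .., ^i, .., ^j, .., v_k).
   The index i < j ranges over 'I_k.+1, so that lift j i has value i, and
   w := v \o lift j is v with v_j removed. *)
Definition ced (k : nat) (a : form k.+1) : form k.+2 :=
  fun v => \sum_(j < k.+2) \sum_(i < k.+1 | (i < j)%N)
    let w := fun c => v (lift j c) in
    (-1) ^+ (i + j)%N * a (vcons (lie (w i) (v j)) (fun c => w (lift i c))).

(* The volume form e^1 /\ ... /\ e^n of a basis e. *)
Definition vol (n : nat) (e : n.-tuple g) : form n :=
  fun v => \det (\matrix_(i, j) coord e i (v j)).

Definition ord_cat (k m : nat) (u : 'I_k -> g) (v : 'I_m -> g) :
    'I_(k + m) -> g :=
  fun a => match fintype.split a with inl b => u b | inr c => v c end.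

(* The Hodge star of the inner product and orientation for which e is an
   oriented orthonormal basis:
     ( *a) (v_1, ..., v_m) = 1/k! \sum_(i_1, ..., i_k)
        a (e_(i_1), ..., e_(i_k)) vol (e_(i_1), ..., e_(i_k), v_1, ..., v_m),
   which is the m-form such that b /\ *a = <b, a> vol for every k-form b. *)
Definition hodge (k m : nat) (e : (k + m).-tuple g) (a : form k) : form m :=
  fun v => k`!%:R^-1 *
    \sum_(i : {ffun 'I_k -> 'I_(k + m)})
      let u := fun c => tnth e (i c) in a u * vol e (ord_cat u v).

End Forms.

Section Dimension7.
Variables (R : realType) (g : lieAlgebraType R).
Local Notation form k := (('I_k -> g) -> R).

Section Coframe.
Variable e : 7.-tuple g.

(* Indices are 1-based: dual i is e^i for 1 <= i <= 7. *)
Definition dual (i : nat) : form 1 :=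
  fun v => coord e (inord i.-1 : 'I_7) (v ord0).

Definition dual2 (i j : nat) : form 2 := wedge (dual i) (dual j).

Definition dual3 (i j k : nat) : form 3 := wedge (dual i) (dual2 j k).

Definition G2_model : form 3 :=
  dual3 1 2 7 + dual3 3 4 7 + dual3 5 6 7 + dual3 1 3 5
  - dual3 1 4 6 - dual3 2 3 6 - dual3 2 4 5.

Definition structure_equations (de : 7.-tuple (form 2)) : Prop :=
  forall i : 'I_7, ced (dual i.+1) = tnth de i.

End Coframe.

Definition adapted (phi : form 3) (e : 7.-tuple g) : Prop :=
  basis_of fullv e /\ phi = G2_model e.

Definition positive (phi : form 3) : Prop := exists e, adapted phi e.

(* The inner product and orientation induced by phi do not depend on the
   adapted basis, hence neither does the Hodge star of phi. *)
Definition coclosed (phi : form 3) : Prop :=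
  exists2 e, adapted phi e & ced (hodge (k := 3) (m := 4) e phi) = 0.

Definition purely_coclosed (phi : form 3) : Prop :=
  coclosed phi /\ wedge phi (ced phi) = 0.

Definition admits_purely_coclosed_G2 : Prop :=
  exists2 phi, positive phi & purely_coclosed phi.

Definition is_27A : Prop :=
  exists2 e : 7.-tuple g, basis_of fullv e &
    structure_equations e
      [tuple 0; 0; 0; 0; 0; dual2 e 1 2; dual2 e 1 4 + dual2 e 3 5].

Definition is_27B : Prop :=
  exists2 e : 7.-tuple g, basis_of fullv e &
    structure_equations e
      [tuple 0; 0; 0; 0; 0; dual2 e 1 2 + dual2 e 3 4;
                            dual2 e 1 5 + dual2 e 2 3].

End Dimension7.

Arguments indecomposable {R} g.
Arguments two_step_nilpotent {R} g.
Arguments admits_purely_coclosed_G2 {R} g.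
Arguments is_27A {R} g.
Arguments is_27B {R} g.

(* Main.v *)
Require Import Defs.
From HB Require Import structures.
From mathcomp Require Import all_boot all_order all_fingroup all_algebra.
From mathcomp Require Import boolp classical_sets functions reals.
From mathcomp Require Import ring lra zify.

Set Implicit Arguments.
Unset Strict Implicit.
Unset Printing Implicit Defensive.

Import Order.TTheory GRing.Theory Num.Theory.
Local Open Scope ring_scope.

(* Write [z] for the center of [g].  If [g] is indecomposable and 2-step nilpotent then
   [z = [g, g]], and dim g = 7 forces dim z <= 3.

   dim z = 1: [g] is the Heisenberg algebra; in a symplectic basis adjusted so that
   de^7 = e^12 + e^34 - 2 e^56, the model 3-form is purely coclosed.

   dim z = 3: let z* be spanned by e^1, e^2, e^7 and put w_1 = e^35 - e^46,
   w_2 = - e^36 - e^45, w_7 = e^34 + e^56, a basis of the self-dual 2-forms on <e_3..e_6>,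
   so that phi = e^127 + sum e^i /\ w_i.  With A_ij = de^i /\ w_j, phi is coclosed iff A is
   symmetric, and then purely coclosed iff moreover tr A = 0.  Changing the basis of [z]
   replaces A by QA, and such a Q exists as soon as A has rank >= 2.  The self-dual and
   anti-self-dual parts of the structure constants have ranks adding up to at least 3, so
   one of the two orientations of <e_3..e_6> works.

   dim z = 2: the bracket is a pencil of two skew forms on a 5-dimensional space.  Vectors v,
   w in the kernels of the two forms, and u orthogonal to both for both forms, span a common
   isotropic subspace, and a complement can be normalized to exhibit 27A or 27B.  Neither
   algebra is coclosed: if x, y span [z], n = x * y is the cross product and
   theta = (star phi)(x, y, ., .), then d(star phi) = 0 contracted with x or y gives
   de /\ theta = 0 for every e in the dual of [z]; contracting further with n, which spans
   the kernel of theta modulo [z], gives (i_n de) /\ theta = 0, hence i_n de = 0 as theta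
   has rank 4, so that n is a central vector outside [z]. *)

(** * Determinants and wedge products *)

(* A determinant that unfolds by computation, on entries indexed by [nat]. *)
Fixpoint mdet (R : comNzRingType) (n : nat) (f : nat -> nat -> R) : R :=
  if n is n'.+1 then
    foldr (fun i s =>
      (-1) ^+ i * f i 0%N * mdet n' (fun r c => f (bump i r) c.+1) + s)
      0 (iota 0 n)
  else 1.

Lemma foldr_iota_sum (R : nmodType) (F : nat -> R) (m n : nat) :
  foldr (fun i s => F i + s) 0 (iota m n) = \sum_(i < n) F (m + i)%N.
Proof.
elim: n m => [|n IHn] m /=; first by rewrite big_ord0.
by rewrite big_ord_recl addn0 IHn; congr (_ + _); apply: eq_bigr => i _;
  rewrite lift0 addSnnS.
Qed.

Lemma det_mdet (R : comNzRingType) (n : nat) (f : nat -> nat -> R) :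
  \det (\matrix_(i < n, j < n) f i j) = mdet n f.
Proof.
elim: n f => [|n IHn] f; first by rewrite det_mx00.
rewrite (expand_det_col _ ord0).
rewrite [RHS](foldr_iota_sum (fun i => (-1) ^+ i * f i 0%N *
  mdet n (fun r c => f (bump i r) c.+1)) 0 n.+1).
apply: eq_bigr => i _.
rewrite mxE /cofactor addn0 add0n -IHn mulrCA mulrA.
congr (_ * _ * \det _).
by apply/matrixP=> r c; rewrite !mxE lift0.
Qed.

Section Wedge.
Variables (R : comNzRingType) (p q : nat).

Definition block_fun (t : 'S_p) (u : 'S_q) (i : 'I_(p + q)) : 'I_(p + q) :=
  match fintype.split i with
  | inl a => lshift q (t a) | inr b => rshift p (u b) end.

Lemma block_fun_inj t u : injective (block_fun t u).
Proof.
move=> i j; rewrite /block_fun.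
case: (split_ordP i) => a ->; case: (split_ordP j) => b ->.
- by move/lshift_inj/perm_inj->.
- by move/eqP; rewrite eq_lrshift.
- by move/eqP; rewrite eq_rlshift.
- by move/rshift_inj/perm_inj->.
Qed.

Definition block_perm (t : 'S_p) (u : 'S_q) : 'S_(p + q) :=
  perm (@block_fun_inj t u).

Lemma block_perml t u a : block_perm t u (lshift q a) = lshift q (t a).
Proof. by rewrite permE /block_fun (unsplitK (inl a)). Qed.

Lemma block_permr t u b : block_perm t u (rshift p b) = rshift p (u b).
Proof. by rewrite permE /block_fun (unsplitK (inr b)). Qed.

(** A sign is the determinant of a permutation matrix, and the one of [block_perm t u] is block
    diagonal. *)
Lemma sign_block_perm t u :
  (-1) ^+ block_perm t u = (-1) ^+ t * (-1) ^+ u :> R.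
Proof.
rewrite -!det_perm -(@det_ublock R p q _ 0); congr (\det _).
apply/matrixP=> i j.
case: (split_ordP i) => a ->; case: (split_ordP j) => b ->;
  rewrite ?block_mxEul ?block_mxEur ?block_mxEdl ?block_mxEdr !mxE
          ?block_perml ?block_permr.
- by rewrite eq_lshift.
- by rewrite eq_lrshift.
- by rewrite eq_rlshift.
- by rewrite eq_rshift.
Qed.

(** Laplace expansion along a block of rows, summed over all permutations instead of over shuffles;
    each shuffle then counts p! q! times, which is the factor that [wedge] divides by. *)
Lemma laplace_block (A : 'M[R]_(p, p + q)) (B : 'M[R]_(q, p + q)) :
  \sum_(s : 'S_(p + q)) (-1) ^+ s *
    (\det (\matrix_(i, j) A i (s (lshift q j))) *
     \det (\matrix_(i, j) B i (s (rshift p j)))) =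
  (p`! * q`!)%:R * \det (col_mx A B).
Proof.
under eq_bigr do rewrite mulr_suml mulr_sumr.
rewrite exchange_big /=.
under eq_bigr => t _ do under eq_bigr do rewrite 2!mulr_sumr.
under eq_bigr => t _ do rewrite exchange_big /=.
(* Substituting [block_perm t u]^-1 * s for s makes the summand independent of t, u. *)
have inner (t : 'S_p) (u : 'S_q) :
  \sum_(s : 'S_(p + q)) (-1) ^+ s *
     (((-1) ^+ t * \prod_i (\matrix_(i0, j) A i0 (s (lshift q j))) i (t i)) *
      ((-1) ^+ u * \prod_i (\matrix_(i0, j) B i0 (s (rshift p j))) i (u i))) =
  \det (col_mx A B).
  rewrite (reindex_inj (mulgI (block_perm t u)^-1%g)) /=.
  apply: eq_bigr => s _; rewrite odd_permM odd_permV signr_addb sign_block_perm.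
  rewrite big_split_ord /=.
  under [X in _ = _ * (X * _)]eq_bigr do rewrite col_mxEu.
  under [X in _ = _ * (_ * X)]eq_bigr do rewrite col_mxEd.
  have -> : \prod_i (\matrix_(i0, j) A i0
      (((block_perm t u)^-1 * s)%g (lshift q j))) i (t i) =
      \prod_i A i (s (lshift q i)).
    by apply: eq_bigr => i _; rewrite mxE permM -(block_perml t u) permK.
  have -> : \prod_i (\matrix_(i0, j) B i0
      (((block_perm t u)^-1 * s)%g (rshift p j))) i (u i) =
      \prod_i B i (s (rshift p i)).
    by apply: eq_bigr => i _; rewrite mxE permM -(block_permr t u) permK.
  move: (\prod_i A _ _) (\prod_i B _ _) => X Y.
  transitivity (((-1) ^+ t * (-1) ^+ t) * ((-1) ^+ u * (-1) ^+ u) *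
                 ((-1) ^+ s * (X * Y)) : R).
    move: ((-1) ^+ t : R) ((-1) ^+ u : R) ((-1) ^+ s : R).
    by move=> a b c; ring.
  by rewrite -(signr_addb R t t) -(signr_addb R u u) !addbb !mul1r.
under eq_bigr => t _ do under eq_bigr => u _ do rewrite inner.
by rewrite !sumr_const !card_Sn -mulrnA mulr_natl [(q`! * _)%N]mulnC.
Qed.

End Wedge.

(** * Hodge star and wedge products of coordinate forms *)

Section CoordinateForms.
Variables (R : realType) (g : lieAlgebraType R).
Local Notation form k := (('I_k -> g) -> R).

(** Expanding the determinant over permutations [s], each [s] contributes the same volume term, and
    the k! equal contributions cancel the factor 1/k! of [hodge]. *)
Lemma hodge_det (k m : nat) (e : (k + m).-tuple g) (l : 'I_k -> 'I_(k + m)) :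
  free e ->
  hodge e (fun u => \det (\matrix_(i, j) coord e (l i) (u j))) =
  (fun v : 'I_m -> g => vol e (ord_cat (fun c => tnth e (l c)) v)).
Proof.
move=> fe; apply/funext=> v; rewrite /hodge /=.
have coordE i j : coord e i (tnth e j) = (i == j)%:R.
  by rewrite (tnth_nth 0) coord_free // eq_sym.
under eq_bigr => f _ do rewrite mulr_suml.
rewrite exchange_big /=.
have inner (s : 'S_k) :
  \sum_(f : {ffun 'I_k -> 'I_(k + m)}) (-1) ^+ s *
     (\prod_i (\matrix_(i, j) coord e (l i) (tnth e (f j))) i (s i)) *
     vol e (ord_cat (fun c => tnth e (f c)) v) =
  vol e (ord_cat (fun c => tnth e (l c)) v).
  (* The product of Kronecker deltas leaves only the tuple [f] with f o s = l. *)
  rewrite (bigD1 [ffun j => l (s^-1%g j)]) //= [X in _ + X]big1 ?addr0.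
    rewrite big1; last by move=> i _; rewrite mxE coordE ffunE permK eqxx.
    rewrite mulr1 /vol.
    (* Reordering the first k arguments of the volume form by the inverse of [s] gives a second sign
       of [s], which cancels the first. *)
    have -> : \matrix_(i, j) coord e i (ord_cat (fun c => tnth e
                ([ffun j0 => l (s^-1%g j0)] c)) v j) =
      col_perm (block_perm s^-1 1)
        (\matrix_(i, j) coord e i (ord_cat (fun c => tnth e (l c)) v j)).
      apply/matrixP=> i j; rewrite !mxE /ord_cat.
      case: (split_ordP j) => b ->.
        by rewrite block_perml !(unsplitK (inl _)) ffunE.
      by rewrite block_permr !(unsplitK (inr _)) perm1.
    rewrite col_permE det_mulmx det_perm odd_permV sign_block_perm odd_permV.
    by rewrite odd_perm1 expr0 mulr1 mulrCA -signr_addb addbb mulr1.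
  move=> f /eqP nf; have [j lf] : exists j, l j != f (s j).
    apply/existsP; rewrite -negb_forall; apply/negP=> /forallP lf.
    by apply: nf; apply/ffunP=> j; rewrite ffunE (eqP (lf _)) permKV.
  by rewrite (bigD1 j) //= mxE coordE (negPf lf) mul0r mulr0 mul0r.
under eq_bigr do rewrite inner.
rewrite sumr_const card_Sn -(mulr_natl (vol _ _)) mulKf //.
by rewrite pnatr_eq0 -lt0n fact_gt0.
Qed.

Variable e : 7.-tuple g.

(* As in [dual], indices are 1-based; the junk index 0 names the same covector as 1. *)
Definition cc (i : nat) (x : g) : R := coord e (inord i.-1) x.

(** The monomial form indexed by [l]. The degree [k] is a separate argument, so that the type does
    not depend on the list. *)
Definition dlist (k : nat) (l : seq nat) : form k :=
  fun v => \det (\matrix_(i < k, j < k) cc (nth 0%N l i) (v j)).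
Arguments dlist : clear implicits.

(** The sum defining [wedge] is the Laplace sum of the matrix whose two row blocks come from [l1]
    and [l2]. *)
Lemma wedge_dlist (p q : nat) (l1 l2 : seq nat) : size l1 = p ->
  wedge (dlist p l1) (dlist q l2) = dlist (p + q) (l1 ++ l2).
Proof.
move=> sl1; apply/funext=> v; rewrite /wedge /dlist.
set A : 'M[R]_(p, p + q) := \matrix_(i, j) cc (nth 0%N l1 i) (v j).
set B : 'M[R]_(q, p + q) := \matrix_(i, j) cc (nth 0%N l2 i) (v j).
have -> : \det (\matrix_(i < p + q, j < p + q) cc (nth 0%N (l1 ++ l2) i) (v j)) =
          \det (col_mx A B).
  congr (\det _); apply/matrixP=> i j; rewrite mxE; case: (split_ordP i) => a ->.
    by rewrite col_mxEu mxE nth_cat sl1 /= ltn_ord.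
  by rewrite col_mxEd mxE nth_cat sl1 /= ltnNge leq_addr /= addKn.
have nz : (p`! * q`!)%:R != 0 :> R.
  by rewrite pnatr_eq0 muln_eq0 negb_or -!lt0n !fact_gt0.
rewrite -[RHS](mulKf nz); congr (_ * _).
rewrite -laplace_block; apply: eq_bigr => s _.
congr (_ * _); congr (_ * _); congr (\det _); by apply/matrixP=> i j; rewrite !mxE.
Qed.

Lemma dual_dlist (i : nat) : dual e i = dlist 1 [:: i].
Proof. by apply/funext=> v; rewrite /dlist det_mx11 mxE. Qed.

Lemma dual2_dlist (i j : nat) : dual2 e i j = dlist 2 [:: i; j].
Proof. by rewrite /dual2 !dual_dlist wedge_dlist. Qed.

Lemma dual3_dlist (i j k : nat) : dual3 e i j k = dlist 3 [:: i; j; k].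
Proof. by rewrite /dual3 dual2_dlist dual_dlist wedge_dlist. Qed.

Lemma dlist_mdet (k : nat) (l : seq nat) (v : 'I_k.+1 -> g) :
  dlist k.+1 l v = mdet k.+1 (fun i j => cc (nth 0%N l i) (v (inord j))).
Proof.
rewrite -det_mdet; congr (\det _); apply/matrixP=> i j.
by rewrite !mxE inord_val.
Qed.

End CoordinateForms.
Arguments dlist {R g} e k l v.

Section G2Forms.
Variables (R : realType) (g : lieAlgebraType R).
Local Notation form k := (('I_k -> g) -> R).

Lemma hodgeD (k m : nat) (e : (k + m).-tuple g) (a b : form k) :
  hodge e (a + b) = hodge e a + hodge e b.
Proof.
apply/funext=> v; rewrite /hodge -[RHS]mulrDr -big_split /=; congr (_ * _).
by apply: eq_bigr => i _; rewrite -mulrDl.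
Qed.

Lemma hodgeN (k m : nat) (e : (k + m).-tuple g) (a : form k) :
  hodge e (- a) = - hodge e a.
Proof.
apply/funext=> v; rewrite /hodge -[RHS]mulrN -sumrN /=; congr (_ * _).
by apply: eq_bigr => i _; rewrite -mulNr.
Qed.

Variable e : 7.-tuple g.
Hypothesis fe : free e.

(* The Hodge dual of the model 3-form, by [hodge_G2_model]. *)
Definition psi : form 4 :=
  dlist e 4 [:: 1; 2; 3; 4]%N + dlist e 4 [:: 1; 2; 5; 6]%N
  + dlist e 4 [:: 1; 3; 6; 7]%N + dlist e 4 [:: 1; 4; 5; 7]%N
  + dlist e 4 [:: 2; 3; 5; 7]%N - dlist e 4 [:: 2; 4; 6; 7]%N
  + dlist e 4 [:: 3; 4; 5; 6]%N.

Lemma G2_model_dlist :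
  G2_model e =
  dlist e 3 [:: 1; 2; 7]%N + dlist e 3 [:: 3; 4; 7]%N + dlist e 3 [:: 5; 6; 7]%N
  + dlist e 3 [:: 1; 3; 5]%N - dlist e 3 [:: 1; 4; 6]%N
  - dlist e 3 [:: 2; 3; 6]%N - dlist e 3 [:: 2; 4; 5]%N.
Proof. by rewrite /G2_model !dual3_dlist. Qed.

Lemma cc_tnth (i j : nat) : (0 < i <= 7)%N -> (0 < j <= 7)%N ->
  cc e i (tnth e (inord j.-1)) = (i == j)%:R.
Proof.
case: i j => [|i] [|j] //= hi hj; rewrite /cc /= (tnth_nth 0) coord_free //.
by rewrite -val_eqE /= !inordK // eqSS eq_sym.
Qed.

(** The first three columns hold the basis vectors named by [l], the last four the arguments of the
    4-form. Rows count from 0 and form indices from 1, hence [i.+1]. *)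
Lemma hodge_dlist3 (l : seq nat) (v : 'I_4 -> g) :
  all (fun i => 0 < i <= 7)%N l -> size l = 3 ->
  hodge (k := 3) (m := 4) e (dlist e 3 l) v =
  mdet 7 (fun i j => if (j < 3)%N then (i.+1 == nth 0%N l j)%:R
                     else cc e i.+1 (v (inord (j - 3)))).
Proof.
move=> /allP hl sl.
rewrite [dlist e 3 l](_ : _ = fun u => \det (\matrix_(i, j)
   coord e (inord (nth 0%N l i).-1 : 'I_(3 + 4)) (u j))) // hodge_det //.
rewrite -det_mdet; congr (\det _); apply/matrixP=> i j; rewrite !mxE /ord_cat.
case: (split_ordP (j : 'I_(3 + 4))) => b ->.
  have hb : (0 < nth 0%N l b <= 7)%N by apply: hl; rewrite mem_nth // sl.
  have hi : (0 < i.+1 <= 7)%N by exact: ltn_ord.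
  by rewrite -(cc_tnth hi hb) /cc /= inord_val.
by rewrite /= addKn inord_val /cc /= inord_val.
Qed.

Lemma mdet_col_delta (S : comNzRingType) (n a : nat) (f : nat -> nat -> S) :
  (a <= n)%N -> (forall i, (i <= n)%N -> f i 0%N = (i == a)%:R) ->
  mdet n.+1 f = (-1) ^+ a * mdet n (fun r c => f (bump a r) c.+1).
Proof.
move=> an f0; rewrite -!det_mdet (expand_det_col _ ord0).
rewrite (bigD1 (inord a)) //= big1 ?addr0.
  rewrite mxE f0 inordK // eqxx mul1r /cofactor addn0 inordK //.
  by congr (_ * \det _); apply/matrixP=> i j; rewrite !mxE lift0 /= inordK.
move=> i ia; rewrite mxE f0; last by rewrite -ltnS.
case: eqP => [E|_]; last by rewrite mul0r.
by move: ia; rewrite -val_eqE /= inordK // E eqxx.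
Qed.

(** Three successive expansions along unit columns. Each deletes a row, so the later positions drop
    to [b.-1] and [c.-2], and the nested [bump] enumerates the complementary indices. *)
Lemma hodge_dlist3_compl (a b c : nat) (v : 'I_4 -> g) : (a < b < c)%N -> (c < 7)%N ->
  hodge (k := 3) (m := 4) e (dlist e 3 [:: a.+1; b.+1; c.+1]) v =
  (-1) ^+ (a + b.-1 + c.-2) *
  dlist e 4 [seq (bump a (bump b.-1 (bump c.-2 r))).+1 | r <- iota 0 4] v.
Proof.
move=> /andP[ab bc] c7; rewrite hodge_dlist3; [|by rewrite /=; lia|by []].
rewrite (@mdet_col_delta _ 6 a); [|lia|by []].
rewrite (@mdet_col_delta _ 5 b.-1); [|lia|]; last first.
  move=> i _; congr (_%:R); congr nat_of_bool.
  by apply/eqP/eqP; rewrite /= /bump; lia.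
rewrite (@mdet_col_delta _ 4 c.-2); [|lia|]; last first.
  move=> i _; congr (_%:R); congr nat_of_bool.
  by apply/eqP/eqP; rewrite /= /bump; lia.
rewrite !mulrA -!exprD; congr (_ * _).
rewrite dlist_mdet -!det_mdet; congr (\det _); apply/matrixP=> i j; rewrite !mxE.
by case: i => [[|[|[|[|i]]]] hi] //; rewrite !subSS subn0.
Qed.

Lemma hodge_G2_model : hodge (k := 3) (m := 4) e (G2_model e) = psi.
Proof.
rewrite G2_model_dlist !(hodgeD, hodgeN); apply/funext=> v.
rewrite /psi !fctE.
rewrite !hodge_dlist3_compl //=.
rewrite /bump /=.

ring.
Qed.
End G2Forms.

(** * The Chevalley-Eilenberg differential in coordinates *)

Section Differential.
Variables (R : realType) (g : lieAlgebraType R) (e : 7.-tuple g).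

(** Like [mdet], it unfolds by computation, which exposes the individual terms to [ring]. *)
Definition sum_lt (n : nat) (F : nat -> nat -> R) : R :=
  foldr (fun j s => foldr (fun i t => F i j + t) 0 (iota 0 j) + s)
    0 (iota 0 n).

Lemma sum_ltE (n : nat) (F : nat -> nat -> R) :
  \sum_(j < n.+1) \sum_(i < n | (i < j)%N) F i j = sum_lt n.+1 F.
Proof.
rewrite /sum_lt (foldr_iota_sum (fun j => foldr (fun i t => F i j + t) 0 (iota 0 j))).
apply: eq_bigr => j _; rewrite add0n (foldr_iota_sum (F^~ _)).
rewrite (big_ord_widen_cond n xpredT (fun i => F (0 + i)%N (j : nat))) ?ltnS //.
by rewrite -ltnS.
Qed.

Lemma ced_sum_lt (k : nat) (a : ('I_k.+1 -> g) -> R) (v : 'I_k.+2 -> g) :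
  ced a v = sum_lt k.+2 (fun i j => (-1) ^+ (i + j) *
    a (fun c : 'I_k.+1 => if nat_of_ord c is c'.+1 then v (inord (bump j (bump i c')))
       else lie (v (inord i)) (v (inord j)))).
Proof.
rewrite -sum_ltE /ced; apply: eq_bigr => j _; apply: eq_bigr => i ij.
congr (_ * a _); apply/funext=> c.
rewrite /vcons; case: (unliftP ord0 c) => [d|] -> /=.
  by congr (v _); apply: val_inj; rewrite /= inordK // (ltn_ord (lift j (lift i d))).
congr (lie (v _) (v _)); apply: val_inj; rewrite /= inordK ?ltn_ord //.
  by rewrite /bump leqNgt ij.
exact: ltn_trans (ltn_ord _) _.
Qed.

Lemma ced_dlist (k : nat) (l : seq nat) (v : 'I_k.+2 -> g) :
  ced (dlist e k.+1 l) v = sum_lt k.+2 (fun i j => (-1) ^+ (i + j) *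
    mdet k.+1 (fun r c => cc e (nth 0%N l r)
      (if c is c'.+1 then v (inord (bump j (bump i c')))
       else lie (v (inord i)) (v (inord j))))).
Proof.
rewrite ced_sum_lt -!sum_ltE; apply: eq_bigr => j _; apply: eq_bigr => i _.
by congr (_ * _); rewrite -det_mdet.
Qed.

Lemma cedD (k : nat) (a b : ('I_k.+1 -> g) -> R) : ced (a + b) = ced a + ced b.
Proof.
apply/funext=> v; rewrite /ced -[RHS]big_split; apply: eq_bigr => j _.
by rewrite -big_split; apply: eq_bigr => i _; rewrite /= -mulrDr.
Qed.

Definition minor (p q : nat) (x y : g) : R :=
  cc e p x * cc e q y - cc e q x * cc e p y.

(* The wedge product of a 2-form b with the covectors of l. *)
Definition wedge2 (k : nat) (b : g -> g -> R) (l : seq nat)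
    (v : 'I_k.+2 -> g) : R :=
  sum_lt k.+2 (fun i j => - (-1) ^+ (i + j) * b (v (inord i)) (v (inord j)) *
    mdet k (fun r c => cc e (nth 0%N l r) (v (inord (bump j (bump i c)))))).

Lemma eq_wedge2 (k : nat) (b b' : g -> g -> R) l (v : 'I_k.+2 -> g) :
  (forall x y, b x y = b' x y) -> wedge2 b l v = wedge2 b' l v.
Proof.
by move=> bb'; congr wedge2; apply/funext=> x; apply/funext=> y.
Qed.

Lemma wedge2D (k : nat) (b b' : g -> g -> R) l (v : 'I_k.+2 -> g) :
  wedge2 (fun x y => b x y + b' x y) l v = wedge2 b l v + wedge2 b' l v.
Proof.
rewrite /wedge2 -!sum_ltE -big_split; apply: eq_bigr => j _.
by rewrite -big_split; apply: eq_bigr => i _; rewrite mulrDr mulrDl.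
Qed.

Lemma wedge2Z (k : nat) (a : R) (b : g -> g -> R) l (v : 'I_k.+2 -> g) :
  wedge2 (fun x y => a * b x y) l v = a * wedge2 b l v.
Proof.
rewrite /wedge2 -!sum_ltE mulr_sumr; apply: eq_bigr => j _.
rewrite mulr_sumr; apply: eq_bigr => i _.
by rewrite [_ * (a * _)]mulrCA -!mulrA.
Qed.

Lemma wedge2_0 (k : nat) l (v : 'I_k.+2 -> g) : wedge2 (fun _ _ => 0) l v = 0.
Proof.
by rewrite /wedge2 -!sum_ltE big1 // => j _; rewrite big1 // => i _; rewrite mulr0 mul0r.
Qed.

Lemma wedge2_minor2 p q a b (v : 'I_4 -> g) :
  wedge2 (minor p q) [:: a; b] v = dlist e 4 [:: p; q; a; b] v.
Proof.
rewrite dlist_mdet /wedge2 /sum_lt /= /bump /= /minor.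
ring.
Qed.

Lemma wedge2_minor3 p q a b c (v : 'I_5 -> g) :
  wedge2 (minor p q) [:: a; b; c] v = dlist e 5 [:: p; q; a; b; c] v.
Proof.
rewrite dlist_mdet /wedge2 /sum_lt /= /bump /= /minor.
ring.
Qed.

(** The 2-form de^i as a function of two vectors, see [ced_dual]. *)
Definition dcc (i : nat) (x y : g) : R := - cc e i (lie x y).

(** The Leibniz rule. It comes from expanding each determinant along the column that holds the
    bracket. *)
Lemma ced_dlist3 a b c (v : 'I_4 -> g) :
  ced (dlist e 3 [:: a; b; c]) v =
  wedge2 (dcc a) [:: b; c] v - wedge2 (dcc b) [:: a; c] v
  + wedge2 (dcc c) [:: a; b] v.
Proof.
rewrite ced_dlist /wedge2 /sum_lt /= /bump /= /dcc.
ring.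
Qed.

Lemma ced_dlist4 a b c d (v : 'I_5 -> g) :
  ced (dlist e 4 [:: a; b; c; d]) v =
  wedge2 (dcc a) [:: b; c; d] v - wedge2 (dcc b) [:: a; c; d] v
  + wedge2 (dcc c) [:: a; b; d] v - wedge2 (dcc d) [:: a; b; c] v.
Proof.
rewrite ced_dlist /wedge2 /sum_lt /= /bump /= /dcc.
ring.
Qed.

End Differential.

(** * Computing with combinations of basis forms *)

(* The boolean is the parity of the number of transpositions performed. *)
Fixpoint insort (x : nat) (l : seq nat) : bool * seq nat :=
  if l is y :: l' then
    if (x <= y)%N then (false, x :: l)
    else let r := insort x l' in (~~ r.1, y :: r.2)
  else (false, [:: x]).

Fixpoint isort (l : seq nat) : bool * seq nat :=
  if l is x :: l' then
    let r := isort l' in let s := insort x r.2 in (r.1 (+) s.1, s.2)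
  else (false, [::]).

Section FormCombinations.
Variables (R : realType) (g : lieAlgebraType R) (e : 7.-tuple g).

Lemma dlist_swap (k : nat) (s1 s2 : seq nat) (x y : nat) (v : 'I_k -> g) :
  size (s1 ++ x :: y :: s2) = k ->
  dlist e k (s1 ++ x :: y :: s2) v = - dlist e k (s1 ++ y :: x :: s2) v.
Proof.
move=> sk; have h1 : ((size s1).+1 < k)%N by rewrite -sk size_cat /=; lia.
have h0 := ltnW h1; pose i0 := Ordinal h0; pose i1 := Ordinal h1.
rewrite /dlist.
have -> : \matrix_(i < k, j < k) cc e (nth 0%N (s1 ++ x :: y :: s2) i) (v j) =
  xrow i0 i1 (\matrix_(i < k, j < k) cc e (nth 0%N (s1 ++ y :: x :: s2) i) (v j)).
  apply/matrixP=> i j; rewrite !mxE; congr (cc e _ _).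
  case: tpermP => [->|->|/eqP ni0 /eqP ni1]; rewrite !nth_cat /=.
  - by rewrite ltnn subnn ltnNge leqnSn /= subSnn.
  - by rewrite ltnn subnn ltnNge leqnSn /= subSnn.
  - case: ltnP => // le; move: ni0 ni1; rewrite -!val_eqE /= => ni0 ni1.
    by have [m ->] : exists m, (i - size s1 = m.+2)%N by exists (i - size s1 - 2)%N; lia.
rewrite xrowE det_mulmx det_perm odd_tperm -val_eqE /= -[X in X == _]addn0.
by rewrite -addn1 eqn_add2l expr1 mulN1r.
Qed.

Lemma size_insort x l : size (insort x l).2 = (size l).+1.
Proof. by elim: l => //= y l IH; case: ifP => //= _; rewrite IH. Qed.

Lemma size_isort l : size (isort l).2 = size l.
Proof. by elim: l => //= x l IH; rewrite size_insort IH. Qed.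

Lemma dlist_insort (k : nat) (s l : seq nat) (x : nat) (v : 'I_k -> g) :
  size (s ++ x :: l) = k ->
  dlist e k (s ++ x :: l) v =
  (-1) ^+ (insort x l).1 * dlist e k (s ++ (insort x l).2) v.
Proof.
elim: l s => [|y l IH] s sk /=; first by rewrite mul1r.
case: ifP => _; first by rewrite mul1r.
rewrite dlist_swap // -cat_rcons IH; last first.
  by rewrite -sk cat_rcons !size_cat /=.
by rewrite cat_rcons -mulNr /= signrN.
Qed.

Lemma dlist_isort (k : nat) (s l : seq nat) (v : 'I_k -> g) :
  size (s ++ l) = k ->
  dlist e k (s ++ l) v = (-1) ^+ (isort l).1 * dlist e k (s ++ (isort l).2) v.
Proof.
elim: l s => [|x l IH] s sk /=; first by rewrite mul1r.
rewrite -cat_rcons IH; last by rewrite cat_rcons.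
rewrite cat_rcons dlist_insort; last by rewrite -sk !size_cat /= size_isort.
by rewrite mulrA signr_addb.
Qed.

Lemma dlist_dup (k : nat) (l : seq nat) (v : 'I_k -> g) :
  size l = k -> ~~ uniq l -> dlist e k l v = 0.
Proof.
move=> sk /(uniqPn 0%N) [i [j [ij jl E]]]; rewrite sk in jl.
rewrite /dlist (@determinant_alternate _ _ _ (Ordinal (ltn_trans ij jl)) (Ordinal jl)) //.
  by rewrite -val_eqE /= neq_ltn ij.
by move=> m; rewrite !mxE /= E.
Qed.

(** A normal form: monomials that agree up to order become one and the same atom for [ring], and
    those with a repeated index disappear. *)
Definition nlist (k : nat) (l : seq nat) (v : 'I_k -> g) : R :=
  if uniq l then (-1) ^+ (isort l).1 * dlist e k (isort l).2 v else 0.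

Lemma dlist_nlist (k : nat) (l : seq nat) (v : 'I_k -> g) :
  size l = k -> dlist e k l v = nlist l v.
Proof.
move=> sk; rewrite /nlist; case: ifP => [_|/negbT/dlist_dup->//].
exact: (@dlist_isort k [::]).
Qed.

(** Forms are kept as lists of terms so that wedge and d become list operations that can be
    evaluated. *)
Definition lcomb (k : nat) (F : seq (R * seq nat)) (v : 'I_k -> g) : R :=
  foldr (fun t s => t.1 * dlist e k t.2 v + s) 0 F.

Lemma lcomb_cat (k : nat) F G (v : 'I_k -> g) :
  lcomb (F ++ G) v = lcomb F v + lcomb G v.
Proof. by elim: F => [|t F IH] /=; rewrite ?add0r // IH addrA. Qed.

Lemma lcomb_nlist (k : nat) F (v : 'I_k -> g) :
  all (fun t => size t.2 == k) F ->
  lcomb F v = foldr (fun t s => t.1 * nlist t.2 v + s) 0 F.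
Proof. by elim: F => [|t F IH] //= /andP[/eqP st /IH->]; rewrite dlist_nlist. Qed.

Lemma lcombE (k : nat) F (v : 'I_k -> g) :
  lcomb F v = \sum_(t <- F) t.1 * dlist e k t.2 v.
Proof. by elim: F => [|t F IH]; rewrite ?big_nil ?big_cons //= IH. Qed.

Lemma wedge_lcomb (p q : nat) F G :
  all (fun t => size t.2 == p) F ->
  wedge (lcomb (k := p) F) (lcomb (k := q) G) =
  lcomb (k := p + q) [seq (t.1 * u.1, t.2 ++ u.2) | t <- F, u <- G].
Proof.
move=> sF; apply/funext=> v; rewrite lcombE big_allpairs_dep /=.
rewrite /wedge.
under [in LHS]eq_bigr => s _ do rewrite !lcombE mulr_suml mulr_sumr.
rewrite exchange_big mulr_sumr; apply: eq_big_seq => t tF.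
under [in LHS]eq_bigr => s _ do rewrite mulr_sumr mulr_sumr.
rewrite exchange_big mulr_sumr; apply: eq_bigr => u _.
have /eqP st := allP sF _ tF; rewrite -(wedge_dlist e q u.2 st) /wedge.
rewrite /= [in RHS]mulrCA; congr (_ * _); rewrite mulr_sumr.
by apply: eq_bigr => s _; rewrite [in RHS]mulrCA; congr (_ * _); exact: mulrACA.
Qed.

Lemma cedZ (k : nat) (c : R) (a : ('I_k.+1 -> g) -> R) v :
  ced (fun v => c * a v) v = c * ced a v.
Proof.
rewrite /ced mulr_sumr; apply: eq_bigr => j _.
by rewrite mulr_sumr; apply: eq_bigr => i _; rewrite /= mulrCA.
Qed.

Lemma ced_lcomb (k : nat) F (v : 'I_k.+2 -> g) :
  ced (lcomb (k := k.+1) F) v = foldr (fun t s => t.1 * ced (dlist e k.+1 t.2) v + s) 0 F.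
Proof.
elim: F => [|t F IH] /=.
  by rewrite /ced big1 // => j _; rewrite big1 // => i _; rewrite mulr0.
rewrite -IH -cedZ.
by rewrite [lcomb (t :: F)](_ : _ = (fun v => t.1 * dlist e k.+1 t.2 v) + lcomb F) ?cedD.
Qed.

(* (k, (p, q)) in [T i] stands for a term k e^pq of de^i. *)
Variable T : nat -> seq (R * (nat * nat)).
Hypothesis dT : forall i x y, (0 < i <= 7)%N ->
  dcc e i x y = foldr (fun t s => t.1 * minor e t.2.1 t.2.2 x y + s) 0 (T i).

(** The Leibniz rule on one monomial. The 2-form de^i replacing the factor at position r is moved to
    the front at no cost, so the only sign is (-1)^r from d passing r covectors. *)
Definition dterm (t : R * seq nat) : seq (R * seq nat) :=
  flatten [seq [seq ((-1) ^+ r * t.1 * u.1,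
                     [:: u.2.1, u.2.2 & take r t.2 ++ drop r.+1 t.2])
               | u <- T (nth 0%N t.2 r)] | r <- iota 0 (size t.2)].

Lemma wedge2_lcomb2 i a b (v : 'I_4 -> g) : (0 < i <= 7)%N ->
  wedge2 e (dcc e i) [:: a; b] v =
  lcomb [seq (u.1, [:: u.2.1; u.2.2; a; b]) | u <- T i] v.
Proof.
move=> hi; rewrite (eq_wedge2 _ _ _ (fun x y => dT x y hi)).
elim: (T i) => [|u U IH] /=; first by rewrite wedge2_0.
by rewrite wedge2D wedge2Z IH wedge2_minor2.
Qed.

Lemma wedge2_lcomb3 i a b c (v : 'I_5 -> g) : (0 < i <= 7)%N ->
  wedge2 e (dcc e i) [:: a; b; c] v =
  lcomb [seq (u.1, [:: u.2.1; u.2.2; a; b; c]) | u <- T i] v.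
Proof.
move=> hi; rewrite (eq_wedge2 _ _ _ (fun x y => dT x y hi)).
elim: (T i) => [|u U IH] /=; first by rewrite wedge2_0.
by rewrite wedge2D wedge2Z IH wedge2_minor3.
Qed.

Lemma lcombZ (k : nat) (c : R) F (v : 'I_k -> g) :
  lcomb [seq (c * t.1, t.2) | t <- F] v = c * lcomb F v.
Proof. by elim: F => [|t F IH] /=; rewrite ?mulr0 // IH mulrDr mulrA. Qed.

Lemma ced_lcomb3 F :
  all (fun t => (size t.2 == 3) && all (fun i => 0 < i <= 7)%N t.2) F ->
  ced (lcomb (k := 3) F) = lcomb (k := 4) (flatten [seq dterm t | t <- F]).
Proof.
move=> hF; apply/funext=> v; rewrite ced_lcomb.
elim: F hF => [|[c l] F IH] //= /andP[/andP[/eqP sl hl] hF].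
rewrite lcomb_cat -IH //; congr (_ + _).
case: l sl hl => [|i1 [|i2 [|i3 [|]]]] //= _ /and4P[h1 h2 h3 _].
rewrite ced_dlist3 !wedge2_lcomb2 // /dterm /= !lcomb_cat addr0 !mulrDr.
rewrite !addrA mulrN -mulNr -!lcombZ -!map_comp.
congr (_ + _ + _); congr (lcomb _ _); apply: eq_map => u /=; congr (_, _); ring.
Qed.

Lemma ced_lcomb4 F :
  all (fun t => (size t.2 == 4) && all (fun i => 0 < i <= 7)%N t.2) F ->
  ced (lcomb (k := 4) F) = lcomb (k := 5) (flatten [seq dterm t | t <- F]).
Proof.
move=> hF; apply/funext=> v; rewrite ced_lcomb.
elim: F hF => [|[c l] F IH] //= /andP[/andP[/eqP sl hl] hF].
rewrite lcomb_cat -IH //; congr (_ + _).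
case: l sl hl => [|i1 [|i2 [|i3 [|i4 [|]]]]] //= _ /and5P[h1 h2 h3 h4 _].
rewrite ced_dlist4 !wedge2_lcomb3 // /dterm /= !lcomb_cat addr0 !mulrDr.
rewrite !addrA !mulrN -!mulNr -!lcombZ -!map_comp.
congr (_ + _ + _ + _); congr (lcomb _ _); apply: eq_map => u /=; congr (_, _); ring.
Qed.

End FormCombinations.

(** * Sufficient conditions for a purely coclosed structure *)

Section PurelyCoclosed.
Variables (R : realType) (g : lieAlgebraType R).

Definition G2_terms : seq (R * seq nat) :=
  [:: (1, [:: 1; 2; 7]%N); (1, [:: 3; 4; 7]%N); (1, [:: 5; 6; 7]%N);
      (1, [:: 1; 3; 5]%N); (-1, [:: 1; 4; 6]%N); (-1, [:: 2; 3; 6]%N);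
      (-1, [:: 2; 4; 5]%N)].

Definition psi_terms : seq (R * seq nat) :=
  [:: (1, [:: 1; 2; 3; 4]%N); (1, [:: 1; 2; 5; 6]%N); (1, [:: 1; 3; 6; 7]%N);
      (1, [:: 1; 4; 5; 7]%N); (1, [:: 2; 3; 5; 7]%N); (-1, [:: 2; 4; 6; 7]%N);
      (1, [:: 3; 4; 5; 6]%N)].

Lemma G2_model_lcomb (e : 7.-tuple g) : G2_model e = lcomb e G2_terms.
Proof.
rewrite G2_model_dlist; apply/funext=> v; rewrite /lcomb /= !fctE; ring.
Qed.

Lemma psi_lcomb (e : 7.-tuple g) : psi e = lcomb e psi_terms.
Proof.
apply/funext=> v; rewrite /psi /lcomb /= !fctE; ring.
Qed.

(** Reduces both conditions on the model 3-form to the vanishing of explicit lists of terms, which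
    sorting the indices and [ring] then decide. *)
Lemma purely_coclosed_terms (e : 7.-tuple g) (T : nat -> seq (R * (nat * nat))) :
  basis_of fullv e ->
  (forall i x y, (0 < i <= 7)%N ->
    dcc e i x y = foldr (fun t s => t.1 * minor e t.2.1 t.2.2 x y + s) 0 (T i)) ->
  (forall v : 'I_5 -> g,
    lcomb e (flatten [seq dterm T t | t <- psi_terms]) v = 0) ->
  (forall v : 'I_7 -> g,
    lcomb e [seq (t.1 * u.1, t.2 ++ u.2) |
             t <- G2_terms, u <- flatten [seq dterm T t | t <- G2_terms]] v = 0) ->
  admits_purely_coclosed_G2 g.
Proof.
move=> be dT d5 d7.
exists (G2_model e); first by exists e.
split.
  exists e => //; rewrite hodge_G2_model ?(basis_free be) // psi_lcomb.
  by rewrite (ced_lcomb4 dT) //; apply/funext=> v; apply: d5.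
rewrite G2_model_lcomb (ced_lcomb3 dT) //.
by rewrite (@wedge_lcomb _ _ e 3 4) //; apply/funext=> v; apply: d7.
Qed.

Definition de_17 (i : nat) : seq (R * (nat * nat)) :=
  if i == 7%N then [:: (1, (1, 2)%N); (1, (3, 4)%N); (-2, (5, 6)%N)] else [::].

(** Put w = e^12 + e^34 + e^56. The terms of star phi containing e^7 take one further index from
    each of the pairs 12, 34, 56, so de^7 kills them. Since phi /\ dphi = w /\ w /\ de^7 /\ e^7, it
    is proportional to 1 + 1 - 2 = 0. *)
Lemma purely_coclosed_17 (e : 7.-tuple g) :
  basis_of fullv e ->
  (forall i x y, (0 < i <= 7)%N ->
    dcc e i x y = foldr (fun t s => t.1 * minor e t.2.1 t.2.2 x y + s) 0 (de_17 i)) ->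
  admits_purely_coclosed_G2 g.
Proof.
move=> be dT; apply: (purely_coclosed_terms be dT) => v.
  rewrite lcomb_nlist //.
  by cbn -[GRing.zero GRing.add GRing.mul GRing.opp]; rewrite /nlist /=; ring.
rewrite lcomb_nlist //.
by cbn -[GRing.zero GRing.add GRing.mul GRing.opp]; rewrite /nlist /=; ring.
Qed.

Variable D : nat -> nat -> nat -> R.

Definition de_37 (i : nat) : seq (R * (nat * nat)) :=
  if i \in [:: 1; 2; 7]%N then
    [:: (D i 3 4, (3, 4)%N); (D i 3 5, (3, 5)%N); (D i 3 6, (3, 6)%N);
        (D i 4 5, (4, 5)%N); (D i 4 6, (4, 6)%N); (D i 5 6, (5, 6)%N)]
  else [::].

(* The hypotheses say that the matrix A_ij = de^i /\ w_j (i, j in {1, 2, 7}) is symmetric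
   and traceless. *)
Lemma purely_coclosed_37 (e : 7.-tuple g) :
  basis_of fullv e ->
  (forall i x y, (0 < i <= 7)%N ->
    dcc e i x y = foldr (fun t s => t.1 * minor e t.2.1 t.2.2 x y + s) 0 (de_37 i)) ->
  D 2 3 5 = - (D 1 3 6 + D 1 4 5) + D 2 4 6 ->
  D 7 3 5 = D 1 3 4 + D 1 5 6 + D 7 4 6 ->
  D 7 3 6 = - (D 2 3 4 + D 2 5 6) - D 7 4 5 ->
  D 7 3 4 = - D 7 5 6 - (D 1 3 5 - D 1 4 6) + D 2 3 6 + D 2 4 5 ->
  admits_purely_coclosed_G2 g.
Proof.
move=> be dT s12 s17 s27 t0; apply: (purely_coclosed_terms be dT) => v.
  rewrite lcomb_nlist //.
  cbn -[GRing.zero GRing.add GRing.mul GRing.opp]; rewrite /nlist /=.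
  rewrite s12 s17 s27 t0.
  ring.
rewrite lcomb_nlist //.
cbn -[GRing.zero GRing.add GRing.mul GRing.opp]; rewrite /nlist /=.
rewrite s12 s17 s27 t0.
ring.
Qed.

End PurelyCoclosed.

(** * No coclosed structure when the center has dimension 2 *)

Section CrossProduct.
Variables (R : comNzRingType) (X Y : nat -> R).

(** Pluecker coordinates of the plane spanned by X and Y. *)
Definition pl (i j : nat) : R := X i * Y j - X j * Y i.

Arguments pl (_ _)%_N.

(** The 4-form [psi] on vectors given by their coordinates, see [psi_polyE]. *)
Definition psi_poly (A B C E : nat -> R) : R :=
  foldr (fun t s => t.1 * mdet 4 (fun i j =>
    (nth (fun _ => 0) [:: A; B; C; E] j) (nth 0%N t.2 i)) + s) 0
  [:: (1, [:: 1; 2; 3; 4]%N); (1, [:: 1; 2; 5; 6]%N); (1, [:: 1; 3; 6; 7]%N);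
      (1, [:: 1; 4; 5; 7]%N); (1, [:: 2; 3; 5; 7]%N); (-1, [:: 2; 4; 6; 7]%N);
      (1, [:: 3; 4; 5; 6]%N)].

(* cross k = phi(X, Y, e_k). *)
Definition cross (k : nat) : R :=
  match k with
  | 1%N => pl 2 7 + pl 3 5 - pl 4 6
  | 2%N => - pl 1 7 - pl 3 6 - pl 4 5
  | 3%N => pl 4 7 - pl 1 5 + pl 2 6
  | 4%N => - pl 3 7 + pl 1 6 + pl 2 5
  | 5%N => pl 6 7 + pl 1 3 - pl 2 4
  | 6%N => - pl 5 7 - pl 1 4 - pl 2 3
  | 7%N => pl 1 2 + pl 3 4 + pl 5 6
  | _ => 0
  end.

Definition theta (b c : nat) : R :=
  psi_poly X Y (fun i => (i == b)%:R) (fun i => (i == c)%:R).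

Definition sum7 (F : nat -> R) : R := F 1%N + F 2%N + F 3%N + F 4%N + F 5%N + F 6%N + F 7%N.

Definition gram : R := sum7 (fun i => X i ^+ 2) * sum7 (fun i => Y i ^+ 2)
  - sum7 (fun i => X i * Y i) ^+ 2.

Lemma cross_dotl : sum7 (fun i => cross i * X i) = 0.
Proof. rewrite /sum7 /cross /pl; ring. Qed.

Lemma cross_dotr : sum7 (fun i => cross i * Y i) = 0.
Proof. rewrite /sum7 /cross /pl; ring. Qed.

Lemma cross_norm : sum7 (fun i => cross i ^+ 2) = gram.
Proof. rewrite /gram /sum7 /cross /pl; ring. Qed.

(** If independent, X, Y and their cross product span an associative 3-plane, and the contraction of
    star phi with such a plane is zero. *)
Lemma psi_poly_cross E : psi_poly X Y cross E = 0.
Proof.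
rewrite /psi_poly /mdet /=.  rewrite /bump /= /cross /pl. ring.
Qed.

Definition theta_table (b c : nat) : R :=
  match b, c with
  | 1%N, 2%N => pl 3 4 + pl 5 6
  | 1%N, 3%N => pl 6 7 - pl 2 4
  | 1%N, 4%N => pl 2 3 + pl 5 7
  | 1%N, 5%N => - pl 2 6 - pl 4 7
  | 1%N, 6%N => pl 2 5 - pl 3 7
  | 1%N, 7%N => pl 3 6 + pl 4 5
  | 2%N, 3%N => pl 1 4 + pl 5 7
  | 2%N, 4%N => - pl 1 3 - pl 6 7
  | 2%N, 5%N => pl 1 6 - pl 3 7
  | 2%N, 6%N => pl 4 7 - pl 1 5
  | 2%N, 7%N => pl 3 5 - pl 4 6
  | 3%N, 4%N => pl 1 2 + pl 5 6
  | 3%N, 5%N => pl 2 7 - pl 4 6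
  | 3%N, 6%N => pl 1 7 + pl 4 5
  | 3%N, 7%N => - pl 1 6 - pl 2 5
  | 4%N, 5%N => pl 1 7 + pl 3 6
  | 4%N, 6%N => - pl 2 7 - pl 3 5
  | 4%N, 7%N => pl 2 6 - pl 1 5
  | 5%N, 6%N => pl 1 2 + pl 3 4
  | 5%N, 7%N => pl 1 4 + pl 2 3
  | 6%N, 7%N => pl 1 3 - pl 2 4
  | _, _ => 0
  end.

Definition thetac (b c : nat) : R :=
  if (b < c)%N then theta_table b c else - theta_table c b.

Lemma thetaE b c : (0 < b <= 7)%N -> (0 < c <= 7)%N -> theta b c = thetac b c.
Proof.
move: b c => [|[|[|[|[|[|[|[|b]]]]]]]] [|[|[|[|[|[|[|[|c]]]]]]]] // _ _;
rewrite /theta /thetac /= /psi_poly /mdet /= /bump /= /pl; ring.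
Qed.

Variable h : nat -> R.

Definition wedge_theta (a b c : nat) : R :=
  h a * thetac b c - h b * thetac a c + h c * thetac a b.

(* As a matrix, theta satisfies theta theta^T = gram * P, with P the orthogonal projection
   onto the complement of X, Y, cross, whence the trace 4 gram.  Contracting h /\ theta with
   theta thus yields gram * h up to the terms that depend only on h(X), h(Y), h(cross). *)
Lemma gram_mulE a : (0 < a <= 7)%N ->
  gram * h a =
  foldr (fun b s => foldr (fun c t =>
      if (b < c)%N then thetac b c * wedge_theta a b c + t else t) 0
    (iota 1 7) + s) 0 (iota 1 7)
  - (cross a * sum7 (fun i => cross i * h i)
     + X a * (sum7 (fun i => Y i ^+ 2) * sum7 (fun i => X i * h i)
              - sum7 (fun i => X i * Y i) * sum7 (fun i => Y i * h i))
     + Y a * (sum7 (fun i => X i ^+ 2) * sum7 (fun i => Y i * h i)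
              - sum7 (fun i => X i * Y i) * sum7 (fun i => X i * h i))).
Proof.
move: a => [|[|[|[|[|[|[|[|a]]]]]]]] // _;
rewrite /wedge_theta /thetac /= /gram /sum7 /cross /pl; ring.
Qed.

Lemma gram_annihilates a : (0 < a <= 7)%N ->
  sum7 (fun i => X i * h i) = 0 -> sum7 (fun i => Y i * h i) = 0 ->
  sum7 (fun i => cross i * h i) = 0 ->
  (forall a b c, (0 < a <= 7)%N -> (0 < b <= 7)%N -> (0 < c <= 7)%N ->
     h a * theta b c - h b * theta a c + h c * theta a b = 0) ->
  gram * h a = 0.
Proof.
move=> ha X0 Y0 N0 E0; rewrite gram_mulE // X0 Y0 N0 !mulr0 subrr !mulr0 !addr0 subr0.
have {}E0 b c : (0 < b <= 7)%N -> (0 < c <= 7)%N -> wedge_theta a b c = 0.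
  by move=> hb hc; rewrite /wedge_theta -!thetaE // E0.
by rewrite /= !E0 // !mulr0 !addr0.
Qed.

End CrossProduct.

HB.instance Definition _ (R : realType) (g : lieAlgebraType R) (x : g) :=
  GRing.isLinear.Build R g g *:%R (lie x) (lie_linearr x).

Lemma lieN (R : realType) (g : lieAlgebraType R) (a b : g) : lie a b = - lie b a.
Proof.
have := liexx (a + b); have addl (u v w : g) : lie (u + v) w = lie u w + lie v w.
  by have := lie_linearl w 1 u v; rewrite !scale1r.
by rewrite linearD /= !addl !liexx add0r addr0 => /eqP; rewrite addrC addr_eq0 => /eqP.
Qed.

Section NoCoclosed.
Variables (R : realType) (g : lieAlgebraType R) (e : 7.-tuple g).
Local Notation coords x := (fun i => cc e i x).

Lemma psi_polyE (u : 'I_4 -> g) :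
  psi e u = psi_poly (coords (u (inord 0))) (coords (u (inord 1)))
                     (coords (u (inord 2))) (coords (u (inord 3))).
Proof.
rewrite /psi !fctE !dlist_mdet /psi_poly /mdet /=; ring.
Qed.

(** Meant for a bracket Z, which is a combination of the central vectors X and Y: inserting X
    retains only the Y-coefficient of Z, and inserting Y only the X-coefficient. *)
Lemma psi_poly_lin (X Y Z U V : nat -> R) (l m : R) :
  (forall i, Z i = l * X i + m * Y i) ->
  psi_poly Z X U V = - (m * psi_poly X Y U V) /\ psi_poly Z Y U V = l * psi_poly X Y U V.
Proof.
move=> hZ; rewrite /psi_poly /mdet /= /bump /= !hZ; split; ring.
Qed.

(** This is d psi evaluated on (x, a, b, c, d), up to sign: the four terms with a bracket involving
    the central x drop out and six remain. *)
Lemma ced_psi_central (x a b c d : g) : (forall z, lie x z = 0) -> ced (psi e) = 0 ->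
  psi_poly (coords (lie a b)) (coords x) (coords c) (coords d)
  - psi_poly (coords (lie a c)) (coords x) (coords b) (coords d)
  + psi_poly (coords (lie a d)) (coords x) (coords b) (coords c)
  + psi_poly (coords (lie b c)) (coords x) (coords a) (coords d)
  - psi_poly (coords (lie b d)) (coords x) (coords a) (coords c)
  + psi_poly (coords (lie c d)) (coords x) (coords a) (coords b) = 0.
Proof.
move=> x0 /(congr1 (fun f => f (fun i : 'I_5 => nth 0 [:: x; a; b; c; d] i))).
rewrite ced_sum_lt /sum_lt /= !psi_polyE /= /bump /= !inordK //= !x0.
have z0 A B C : psi_poly (coords (0 : g)) A B C = 0.
  have -> : coords (0 : g) = (fun _ => 0) by apply/funext=> i; rewrite /cc linear0.
  by rewrite /psi_poly /mdet /=; ring.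
rewrite !z0 => H.
rewrite -[RHS]oppr0 -[in RHS](H : _ = 0 :> R); ring.
Qed.

Variables (x y : g).
Hypothesis be : basis_of fullv e.
Hypothesis fxy : free [:: x; y].
Hypothesis x0 : forall z, lie x z = 0.
Hypothesis y0 : forall z, lie y z = 0.
Hypothesis lie_xy : forall a b, lie a b \in <<[:: x; y]>>%VS.
Hypothesis cl : ced (psi e) = 0.

Let X := coords x.
Let Y := coords y.

Definition cross_vec : g := \sum_(i < 7) cross X Y i.+1 *: e`_i.

Lemma cc_cross i : (0 < i <= 7)%N -> cc e i cross_vec = cross X Y i.
Proof.
case: i => // i hi; rewrite /cc /cross_vec coord_sum_free ?(basis_free be) //=.
by rewrite inordK.
Qed.

Lemma cc_eq0 z : (forall i, (0 < i <= 7)%N -> cc e i z = 0) -> z = 0.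
Proof.
move=> z0; rewrite (coord_basis be (memvf z)) big1 // => i _.
by have := z0 i.+1 (ltn_ord i); rewrite /cc /= inord_val => ->; rewrite scale0r.
Qed.

Lemma sum7_eq0 (F : nat -> R) : (forall i, 0 <= F i) -> sum7 F = 0 ->
  forall i, (0 < i <= 7)%N -> F i = 0.
Proof.
move=> F0 s0 [|[|[|[|[|[|[|[|i]]]]]]]] // _; move: s0; rewrite /sum7;
have := (F0 1%N, F0 2%N, F0 3%N, F0 4%N, F0 5%N, F0 6%N, F0 7%N);
move=> [[[[[[? ?] ?] ?] ?] ?] ?] ?; lra.
Qed.

Lemma gram_gt0 : gram X Y != 0.
Proof.
apply/eqP=> g0.
have pl0 : forall i j, (0 < i <= 7)%N -> (0 < j <= 7)%N -> pl X Y i j = 0.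
  move=> i j hi hj; apply/eqP; rewrite -sqrf_eq0; apply/eqP.
  (* Lagrange's identity: the squares of all Pluecker coordinates add up to twice the Gram
     determinant. *)
  have s0 : sum7 (fun i => sum7 (fun j => pl X Y i j ^+ 2)) = 0.
    by rewrite -[RHS](mulr0 2) -g0 /gram /sum7 /pl; ring.
  have F0 k : 0 <= sum7 (fun j => pl X Y k j ^+ 2).
    by rewrite /sum7 !addr_ge0 // sqr_ge0.
  apply: (sum7_eq0 (F := fun j => pl X Y i j ^+ 2) _ (sum7_eq0 F0 s0 hi) hj) => k.
  exact: sqr_ge0.
have [i hi Xi] : exists2 i, (0 < i <= 7)%N & X i != 0.
  apply: contrapT => H.
  have xz : x = 0.
    apply: cc_eq0 => i hi; apply/eqP/negP=> /negP Xi; apply: H; by exists i.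
  by move: fxy; rewrite free_cons xz mem0v.
have yE : y = (Y i / X i) *: x.
  apply/eqP; rewrite -subr_eq0; apply/eqP/cc_eq0 => j hj.
  rewrite /cc linearB linearZ /= -/(cc e j x) -/(cc e j y).
  have := pl0 i j hi hj; rewrite /pl -/(X j) -/(Y j) => /eqP.
  rewrite subr_eq0 => /eqP E; apply: (mulfI Xi).
  by rewrite mulr0 mulrBr E mulrA [X i * (_ / _)]mulrCA mulfV // mulr1 mulrC subrr.
have P : perm_eq [:: x; y] [:: y; x] by apply/permPl/(perm_catC [:: x] [:: y]).
move: fxy; rewrite (perm_free P) free_cons yE.
by rewrite memvZ // memv_span1.
Qed.

Lemma memv_xyP z : z \in <<[:: x; y]>>%VS -> exists a b, z = a *: x + b *: y.
Proof.
rewrite span_cons span_seq1 => /memv_addP[_ /vlineP[a ->] [_ /vlineP[b ->] ->]].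
by exists a, b.
Qed.

(** The cross product is orthogonal to x and y, so inside their span it would have norm zero; its
    squared norm is the nonzero Gram determinant. *)
Lemma cross_notin : cross_vec \notin <<[:: x; y]>>%VS.
Proof.
apply/negP=> /memv_xyP[a [b E]].
have cE i : (0 < i <= 7)%N -> cross X Y i = a * X i + b * Y i.
  by move=> hi; rewrite -cc_cross // E /cc linearD !linearZ.
move: gram_gt0; rewrite -cross_norm.
have -> : sum7 (fun i => cross X Y i ^+ 2) =
    sum7 (fun i => cross X Y i * (a * X i + b * Y i)).
  by rewrite /sum7 !expr2 -!cE.
rewrite (_ : sum7 _ = a * sum7 (fun i => cross X Y i * X i) +
                      b * sum7 (fun i => cross X Y i * Y i)); last first.
  by rewrite /sum7; ring.
by rewrite cross_dotl cross_dotr !mulr0 addr0 eqxx.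
Qed.

Lemma eq_psi_poly (A A' B B' : nat -> R) :
  (forall i, (0 < i <= 7)%N -> A i = A' i) ->
  (forall i, (0 < i <= 7)%N -> B i = B' i) ->
  psi_poly X Y A B = psi_poly X Y A' B'.
Proof.
by move=> EA EB; rewrite /psi_poly /mdet /= /bump /= !EA // !EB.
Qed.

(** A functional killing x, y and their cross product lives on a 4-dimensional quotient where theta
    is nondegenerate, and there the wedge product of covectors with theta is injective. *)
Lemma annihilates (f : {scalar g}) :
  f x = 0 -> f y = 0 -> f cross_vec = 0 ->
  (forall b c d, f b * psi_poly X Y (coords c) (coords d)
    - f c * psi_poly X Y (coords b) (coords d)
    + f d * psi_poly X Y (coords b) (coords c) = 0) ->
  forall z, f z = 0.
Proof.
move=> fx fy fn fE.
pose h i := f e`_i.-1.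
have fz z : f z = sum7 (fun i => cc e i z * h i).
  rewrite [in LHS](coord_basis be (memvf z)) linear_sum /=.
  under eq_bigr do rewrite linearZ /=.
  rewrite /sum7 !big_ord_recl big_ord0 addr0 !addrA /h /cc /=.
  by repeat (congr (_ + _)); congr (coord e _ z * _); apply: val_inj; rewrite /= inordK.
have coordsE b i : (0 < b <= 7)%N -> (0 < i <= 7)%N ->
    cc e i e`_b.-1 = (i == b)%:R.
  move=> hb hi; rewrite -(cc_tnth (basis_free be) hi hb) (tnth_nth 0) inordK //.
  by case: b hb.
have h0 a : (0 < a <= 7)%N -> h a = 0.
  move=> ha; apply: (mulfI gram_gt0); rewrite mulr0.
  apply: gram_annihilates => //; rewrite -?fz //.
    by rewrite -fn fz /sum7 !cc_cross.
  move=> {ha}a b c ha hb hc; rewrite -[RHS](fE e`_a.-1 e`_b.-1 e`_c.-1) /theta.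
  by congr (_ * _ - _ * _ + _ * _); apply: eq_psi_poly => i hi; rewrite coordsE.
by move=> z; rewrite fz /sum7 !h0 // !mulr0 !addr0.
Qed.

Lemma cross_central z : lie cross_vec z = 0.
Proof.
pose XY := [tuple x; y].
have lieE a b : lie a b = coord XY ord0 (lie a b) *: x + coord XY ord_max (lie a b) *: y.
  rewrite [LHS](coord_span (X := XY) (lie_xy a b)) !big_ord_recl big_ord0 addr0 /=.
  by congr (_ + coord _ _ _ *: _); apply: val_inj.
have cE a b i : cc e i (lie a b) =
    coord XY ord0 (lie a b) * X i + coord XY ord_max (lie a b) * Y i.
  by rewrite [in LHS]lieE /cc linearD !linearZ.
have psi0 A : psi_poly X Y (coords cross_vec) A = 0.
  by rewrite -[RHS](psi_poly_cross X Y A); apply: eq_psi_poly => // i hi; rewrite cc_cross.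
have linl a b U V := (psi_poly_lin U V (cE a b)).1.
have linr a b U V := (psi_poly_lin U V (cE a b)).2.
rewrite lieE.
(* Evaluate d psi on (y, n, b, c, d), n being the cross product: the terms in which n is left as an
   argument vanish by [psi0], and y isolates the x-component of the brackets with n. Below, x
   isolates the y-component. *)
have -> : coord XY ord0 (lie cross_vec z) = 0.
  apply: (annihilates (f := coord XY ord0 \o lie cross_vec)) => /=.
  - by rewrite lieN x0 oppr0 linear0.
  - by rewrite lieN y0 oppr0 linear0.
  - by rewrite liexx linear0.
  move=> b c d; have := ced_psi_central cross_vec b c d y0 cl.
  by rewrite !linr !psi0 !mulr0 !addr0 subr0.
have -> : coord XY ord_max (lie cross_vec z) = 0.
  apply: (annihilates (f := coord XY ord_max \o lie cross_vec)) => /=.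
  - by rewrite lieN x0 oppr0 linear0.
  - by rewrite lieN y0 oppr0 linear0.
  - by rewrite liexx linear0.
  move=> b c d; have := ced_psi_central cross_vec b c d x0 cl.
  rewrite !linl !psi0 !mulr0 !oppr0 !addr0 => /eqP; rewrite -oppr_eq0 => /eqP <-.
  by rewrite /=; ring.
by rewrite !scale0r addr0.
Qed.

End NoCoclosed.

(** * Structure of 2-step nilpotent Lie algebras of dimension 7 *)

Section Structure.
Variables (R : realType) (g : lieAlgebraType R).
Implicit Types x y z w : g.

Lemma lieDl x y z : lie (x + y) z = lie x z + lie y z.
Proof. by rewrite -{1}[x]scale1r lie_linearl scale1r. Qed.

Lemma lieZl (a : R) x z : lie (a *: x) z = a *: lie x z.
Proof. by rewrite lieN linearZ /= lieN scalerN opprK. Qed.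

Lemma lieDr x y z : lie x (y + z) = lie x y + lie x z.
Proof. exact: linearD. Qed.

Lemma lieZr (a : R) x z : lie x (a *: z) = a *: lie x z.
Proof. exact: linearZ. Qed.

Lemma lie0l x : lie 0 x = 0 :> g. Proof. by rewrite lieN linear0 oppr0. Qed.

Lemma lie_suml (I : Type) (r : seq I) (P : pred I) (F : I -> g) z :
  lie (\sum_(i <- r | P i) F i) z = \sum_(i <- r | P i) lie (F i) z.
Proof. by rewrite lieN linear_sum -sumrN; apply: eq_bigr => i _; rewrite -lieN. Qed.

Definition center : {vspace g} :=
  (\bigcap_(i < \dim {:g}) lker (linfun (lie (vbasis {:g})`_i)))%VS.

Lemma centerP z : reflect (forall w, lie z w = 0) (z \in center).
Proof.
apply: (iffP idP) => [zc w|zc].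
  rewrite (coord_vbasis (memvf w)) linear_sum big1 // => i _ /=.
  rewrite lieZr; move: zc; rewrite /center => /subv_bigcapP /(_ i isT).
  by rewrite -memvE memv_ker lfunE /= lieN oppr_eq0 => /eqP ->; rewrite scaler0.
by apply/subv_bigcapP => i _; rewrite -memvE memv_ker lfunE /= lieN zc oppr0.
Qed.

Definition derived : {vspace g} :=
  <<[seq lie x y | x <- vbasis {:g}, y <- vbasis {:g}]>>%VS.

Lemma lie_derived x y : lie x y \in derived.
Proof.
rewrite (coord_vbasis (memvf x)) (coord_vbasis (memvf y)) lie_suml memv_suml // => i _.
rewrite linear_sum memv_suml // => j _; rewrite /= lieZl lieZr !memvZ //.
by apply/memv_span/allpairs_f; apply: mem_nth; rewrite size_tuple.
Qed.

Lemma derived_sub (U : {vspace g}) : (forall x y, lie x y \in U) -> (derived <= U)%VS.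
Proof. by move=> h; apply/span_subvP => _ /allpairsP[[x y] /= [_ _ ->]]. Qed.

(** A central z outside [g, g] splits off: the line of z is an ideal, and so is any subspace
    containing [g, g], in particular a complement of that line. *)
Lemma center_derived : indecomposable g -> two_step_nilpotent g -> center = derived.
Proof.
move=> ind [[a [b ab]] st]; apply: subv_anti; apply/andP; split; last first.
  by apply: derived_sub => x y; apply/centerP=> w; rewrite lieN st oppr0.
apply/subvP=> z /centerP zc; apply/negPn/negP => zD; apply: ind.
set E := (derived + <[z]>)%VS.
exists <[z]>%VS, (derived + E^C)%VS; split.
- by move=> x _ /vlineP[c ->]; rewrite lieZr lieN zc oppr0 scaler0 mem0v.
- by move=> x y _; apply/(subvP (addvSl _ _))/lie_derived.
- by apply: contraNneq zD => z0; have := memv_line z; rewrite z0 memv0 => /eqP->; apply: mem0v.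
- apply/eqP=> J0; apply: ab; apply/eqP; rewrite -memv0 -J0.
  by apply/(subvP (addvSl _ _))/lie_derived.
split.
  by rewrite addvA [(<[z]> + _)%VS]addvC addv_complf.
apply/eqP; rewrite -subv0; apply/subvP=> w; rewrite memv_cap memv0.
move=> /andP[/vlineP[c ->] /memv_addP[d dD [u uC E']]].
have [->|c0] := eqVneq c 0; first by rewrite scale0r.
case/negP: zD; have u0 : u = 0.
  apply/eqP; rewrite -memv0 -(capv_compl E) memv_cap uC andbT.
  have -> : u = - d + c *: z by rewrite E' addKr.
  by rewrite memv_add ?memvN // memvZ ?memv_line.
by rewrite -[z](scalerK c0) E' u0 addr0 memvZ.
Qed.

(** A skew-symmetric matrix of odd size is singular. *)
Lemma odd_radical (U : {vspace g}) (f : {scalar g}) : odd (\dim U) ->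
  exists v, [/\ v \in U, v != 0 & forall w, w \in U -> f (lie v w) = 0].
Proof.
move=> oU; set B := vbasis U.
pose A := \matrix_(i < \dim U, j < \dim U) f (lie B`_i B`_j).
have AT : A^T = - A by apply/matrixP=> i j; rewrite !mxE lieN linearN.
have /eqP/det0P[u u0 uA] : \det A = 0.
  have : \det A = - \det A.
    by rewrite -{1}det_tr AT -scaleN1r detZ -signr_odd oU expr1 mulN1r.
  by move=> E; lra.
have vE w : w \in U -> f (lie (\sum_i u 0 i *: B`_i) w) = 0.
  move=> /coord_vbasis ->; rewrite linear_sum linear_sum big1 // => j _.
  rewrite /= lieZr linearZ /= lie_suml linear_sum /=.
  have /matrixP/(_ ord0 j) := uA; rewrite !mxE => E.
  rewrite (_ : \sum_i _ = 0) ?mulr0 // -[RHS]E; apply: eq_bigr => i _.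
  by rewrite lieZl linearZ mxE.
exists (\sum_i u 0 i *: B`_i); split => //.
  by rewrite memv_suml // => i _; rewrite memvZ // vbasis_mem // mem_nth // size_tuple.
apply: contra u0 => /eqP s0; apply/eqP/rowP=> i; rewrite mxE.
have /freeP fB := basis_free (vbasisP U).
by rewrite (fB (u 0)).
Qed.

(** If some element of I is not central, one of its nonzero brackets lies in I, and it is central
    because g is 2-step nilpotent. *)
Lemma ideal_center (I : {vspace g}) : two_step_nilpotent g -> is_ideal I ->
  I != 0%VS -> (0 < \dim (I :&: center))%N.
Proof.
move=> [_ st] iI; rewrite -vpick0 lt0n dimv_eq0 => p0.
have pI := memv_pick I; have [pc|/centerP] := boolP (vpick I \in center).
  by apply: contraNneq p0 => E; rewrite -memv0 -E memv_cap pI.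
move=> /existsNP[w /eqP pw]; apply: contraNneq pw => E.
rewrite -memv0 -E memv_cap lieN memvN iI // memvN; apply/centerP=> z.
by rewrite lieN st oppr0.
Qed.

(* In a decomposition I + J both ideals meet the center in a line, so that the bracket of
   each is a single skew form on a complement of that line.  The two complements have total
   dimension 5, so one is odd-dimensional and its form has a kernel, which is central. *)
Lemma indecomposable_center2 : two_step_nilpotent g -> \dim {:g} = 7%N ->
  \dim center = 2%N -> indecomposable g.
Proof.
move=> ts d7 c2 [I [J [iI iJ I0 J0 [IJ IJ0]]]].
have dI := dimv_cap_compl I center; have dJ := dimv_cap_compl J center.
have dIJ : (\dim I + \dim J = 7)%N by rewrite -d7 -IJ dimv_disjoint_sum.
have hI := ideal_center ts iI I0; have hJ := ideal_center ts iJ J0.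
have h2 : (\dim (I :&: center) + \dim (J :&: center) <= 2)%N.
  rewrite -c2 -dimv_disjoint_sum ?dimvS ?subv_add ?capvSr //.
  apply/eqP; rewrite -subv0 -IJ0 subv_cap (subv_trans (capvSl _ _) (capvSl _ _)).
  exact: subv_trans (capvSr _ _) (capvSl _ _).
wlog oI : I J iI iJ I0 J0 IJ IJ0 dI dJ dIJ hI hJ h2 / odd (\dim (I :\: center)).
  move=> W; have [oI|eI] := boolP (odd (\dim (I :\: center))); first exact: (W I J).
  apply: (W J I) => //; rewrite ?[(J + I)%VS]addvC ?[(J :&: I)%VS]capvC //; lia.
have dIc : \dim (I :&: center) = 1%N by lia.
pose z := tnth (vbasis (I :&: center)) (cast_ord (esym dIc) ord0).
have zE : (I :&: center = <[z]>)%VS.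
  apply/esym/eqP; rewrite eqEdim dIc dim_vline -memvE vbasis_mem ?mem_tnth //=.
  rewrite lt0b; apply: (free_not0 (basis_free (vbasisP (I :&: center)))).
  exact: mem_tnth.
have z0 : free [:: z].
  rewrite free_cons span_nil memv0 nil_free andbT.
  by apply: (free_not0 (basis_free (vbasisP (I :&: center)))); apply: mem_tnth.
pose f : {scalar g} := coord [tuple z] ord0.
have f0 t : t \in (I :&: center)%VS -> f t = 0 -> t = 0.
  rewrite zE => /vlineP[c ->]; rewrite linearZ /= /f.
  by rewrite (coord_free (X := [tuple z]) ord0 ord0 z0) mulr1 => ->; rewrite scale0r.
have liec x y : lie x y \in center.
  by apply/centerP=> w; rewrite lieN ts.2 oppr0.
have [v [vI v0 vf]] := odd_radical f oI.
have vI' : v \in I by apply: (subvP (diffvSl I center)).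
(* Since [v] lies in a complement of the center within [I], showing it central makes it zero. It
   commutes with [J] because I and J meet in 0, and with [I] because [f] is injective on the central
   part of [I]. *)
case/negP: v0; rewrite -memv0 -(capv_diff I center) memv_cap vI /=.
apply/centerP=> w.
have /memv_addP[p pI [q qJ ->]] : w \in (I + J)%VS by rewrite IJ memvf.
have -> : lie v (p + q) = lie v p + lie v q by exact: lieDr.
have -> : lie v q = 0.
  apply/eqP; rewrite -memv0 -IJ0 memv_cap iJ // andbT lieN memvN; exact: iI.
have : p \in (I :\: center + I :&: center)%VS by rewrite addv_diff_cap.
case/memv_addP=> p1 p1I [p2]; rewrite memv_cap => /andP[_ /centerP p2c] ->.
rewrite lieDr [lie v p2]lieN p2c oppr0 !addr0.
apply: f0; last exact: vf.
by rewrite memv_cap liec andbT iI // (subvP (diffvSl I center)).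
Qed.

Lemma not_coclosed_center2 x y : free [:: x; y] -> center = <<[:: x; y]>>%VS ->
  two_step_nilpotent g -> ~ admits_purely_coclosed_G2 g.
Proof.
move=> fxy cE ts [phi _ [[e [be ->] cl] _]].
rewrite hodge_G2_model ?(basis_free be) // in cl.
have inc z : z \in [:: x; y] -> forall w, lie z w = 0.
  by move=> zx; apply/centerP; rewrite cE memv_span.
have x0 := inc x (mem_head _ _).
have y0 := inc y (mem_last x [:: y]).
have liec a b : lie a b \in <<[:: x; y]>>%VS.
  by rewrite -cE; apply/centerP=> w; rewrite lieN ts.2 oppr0.
have /negP[] := cross_notin be fxy.
by rewrite -cE; apply/centerP; exact: (cross_central be fxy x0 y0 liec cl).
Qed.

End Structure.

(** * Algebras with 2-dimensional center *)

Section Classification.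
Variables (R : realType) (g : lieAlgebraType R).
Implicit Types x y z v w : g.

Lemma ced_dual (e : 7.-tuple g) (i : nat) (v : 'I_2 -> g) :
  ced (dual e i) v = dcc e i (v ord0) (v ord_max).
Proof.
rewrite ced_sum_lt /sum_lt /= !addr0 add0r expr1 mulN1r /dual /dcc /cc /=.
congr (- coord e _ (lie (v _) (v _))); apply: val_inj; by rewrite /= inordK.
Qed.

Lemma dual2_minor (e : 7.-tuple g) (i j : nat) (v : 'I_2 -> g) :
  dual2 e i j v = minor e i j (v ord0) (v ord_max).
Proof.
rewrite dual2_dlist dlist_mdet /mdet /= /minor /=.
have -> : inord 0 = ord0 :> 'I_2 by apply: val_inj; rewrite /= inordK.
have -> : inord 1 = ord_max :> 'I_2 by apply: val_inj; rewrite /= inordK.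
by ring.
Qed.

Lemma scalar_lie (e : 7.-tuple g) (f : {scalar g}) x y : basis_of fullv e ->
  f (lie x y) =
  sum_lt 7 (fun i j => minor e i.+1 j.+1 x y * f (lie e`_i e`_j)).
Proof.
move=> be.
have lieE (z t : g) : f (lie z t) = sum7 (fun i => cc e i z * f (lie e`_i.-1 t)).
  rewrite [in LHS](coord_basis be (memvf z)) lie_suml linear_sum /=.
  under eq_bigr do rewrite lieZl linearZ /=.
  rewrite /sum7 !big_ord_recl big_ord0 addr0 !addrA /cc /=.
  by repeat (congr (_ + _)); congr (coord e _ z * _); apply: val_inj; rewrite /= inordK.
rewrite lieE /sum7.
have lieE' t i : f (lie e`_i t) = - sum7 (fun j => cc e j t * f (lie e`_j.-1 e`_i)).
  by rewrite lieN linearN /= lieE.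
rewrite !lieE' /sum7 /= !liexx !linear0 /sum_lt /=.
(* Every bracket of basis vectors is rewritten with the smaller index first, so that [ring] can
   match the terms. *)
have fN i j : f (lie e`_j e`_i) = - f (lie e`_i e`_j) by rewrite lieN linearN.
rewrite !(fN 0%N) !(fN 1%N 2%N) !(fN 1%N 3%N) !(fN 1%N 4%N) !(fN 1%N 5%N) !(fN 1%N 6%N).
rewrite !(fN 2%N 3%N) !(fN 2%N 4%N) !(fN 2%N 5%N) !(fN 2%N 6%N).
rewrite !(fN 3%N 4%N) !(fN 3%N 5%N) !(fN 3%N 6%N).
rewrite !(fN 4%N 5%N) !(fN 4%N 6%N) !(fN 5%N 6%N).
by rewrite /minor; ring.
Qed.

Lemma dcc_basis (e : 7.-tuple g) i x y : basis_of fullv e ->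
  dcc e i x y =
  - sum_lt 7 (fun j k => minor e j.+1 k.+1 x y * cc e i (lie e`_j e`_k)).
Proof.
by move=> be; rewrite /dcc /cc; congr (- _); exact: scalar_lie.
Qed.

Lemma cc0 (e : 7.-tuple g) i : cc e i 0 = 0.
Proof. exact: linear0. Qed.

Lemma ccN (e : 7.-tuple g) i x : cc e i (- x) = - cc e i x.
Proof. exact: linearN. Qed.

Lemma cc_basis (e : 7.-tuple g) i j : basis_of fullv e -> (0 < i <= 7)%N -> (j < 7)%N ->
  cc e i e`_j = (i == j.+1)%:R.
Proof.
move=> be hi hj; rewrite -(cc_tnth (basis_free be) hi (j := j.+1) hj) (tnth_nth 0) /=.
by rewrite inordK.
Qed.

Lemma lie_central z x : (forall w, lie z w = 0) -> lie x z = 0.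
Proof. by move=> zc; rewrite lieN zc oppr0. Qed.

Lemma basis7 (a1 a2 a3 a4 a5 a6 a7 : g) : \dim {:g} = 7%N ->
  (forall k1 k2 k3 k4 k5 k6 k7 : R,
    k1 *: a1 + (k2 *: a2 + (k3 *: a3 + (k4 *: a4 +
      (k5 *: a5 + (k6 *: a6 + k7 *: a7))))) = 0 ->
    [/\ k1 = 0, k2 = 0, k3 = 0, k4 = 0 & [/\ k5 = 0, k6 = 0 & k7 = 0]]) ->
  basis_of fullv [tuple a1; a2; a3; a4; a5; a6; a7].
Proof.
move=> d7 fe; rewrite basisEfree subvf d7 andbT; apply/freeP => k.
rewrite !big_ord_recl big_ord0 /= addr0 => /fe[k1 k2 k3 k4 [k5 k6 k7]].
move=> [[|[|[|[|[|[|[|i]]]]]]] hi] //; [move: k1|move: k2|move: k3|move: k4|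
  move: k5|move: k6|move: k7] => <-; congr k; exact: val_inj.
Qed.

Section Brackets.
Variables (a v c u w z6 z7 : g).
Let e : 7.-tuple g := [tuple a; v; c; u; w; z6; z7].
Hypothesis d7 : \dim {:g} = 7%N.
Hypothesis z6c : forall x, lie z6 x = 0.
Hypothesis z7c : forall x, lie z7 x = 0.
Hypothesis fz : free [:: z6; z7].

Lemma free_pair (s t : R) : s *: z6 + t *: z7 = 0 -> s = 0 /\ t = 0.
Proof.
move=> E; have /freeP fz' : free [tuple z6; z7] by [].
pose k (i : 'I_2) := if i == ord0 then s else t.
have /fz' k0 : \sum_(i < 2) k i *: [tuple z6; z7]`_i = 0.
  by rewrite !big_ord_recl big_ord0 addr0.
by split; [exact: (k0 ord0) | exact: (k0 ord_max)].
Qed.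

Lemma free_basis7 :
  (forall k1 k2 k3 k4 k5 k6 k7 : R,
    k1 *: a + (k2 *: v + (k3 *: c + (k4 *: u + (k5 *: w + (k6 *: z6 + k7 *: z7))))) = 0 ->
    [/\ k1 = 0, k2 = 0, k3 = 0, k4 = 0 & k5 = 0]) -> basis_of fullv e.
Proof.
move=> fe; apply: basis7 => // k1 k2 k3 k4 k5 k6 k7 E.
have [-> -> -> -> ->] := fe _ _ _ _ _ _ _ E; move/fe: (E) => [e1 e2 e3 e4 e5].
by move: E; rewrite e1 e2 e3 e4 e5 !scale0r !add0r => /free_pair[-> ->].
Qed.

(** The minus signs reflect de^i(x, y) = - e^i([x, y]). The seven vectors are independent by the
    bracket relations: bracketing a linear relation with v, w, a, c in turn kills its first five
    coefficients. *)
Lemma is_27A_brackets :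
  lie a v = - z6 -> lie a u = - z7 -> lie c w = - z7 ->
  lie a c = 0 -> lie a w = 0 -> lie v c = 0 -> lie v u = 0 -> lie v w = 0 ->
  lie c u = 0 -> lie u w = 0 -> is_27A g.
Proof.
move=> av au cw ac aw vc vu vw cu uw.
have c6 x : lie x z6 = 0 by exact: lie_central.
have c7 x : lie x z7 = 0 by exact: lie_central.
have va : lie v a = z6 by rewrite lieN av opprK.
have ua : lie u a = z7 by rewrite lieN au opprK.
have wc : lie w c = z7 by rewrite lieN cw opprK.
have [ca wa cv] : [/\ lie c a = 0, lie w a = 0 & lie c v = 0].
  by rewrite !(lieN c) (lieN w) ac aw vc oppr0.
have [uv wv] : lie u v = 0 /\ lie w v = 0 by rewrite (lieN u) (lieN w) vu vw oppr0.
have [uc wu] : lie u c = 0 /\ lie w u = 0 by rewrite (lieN u) (lieN w) cu uw oppr0.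
have z60 : z6 != 0 by apply: (free_not0 fz); rewrite mem_head.
have z70 : z7 != 0 by apply: (free_not0 fz); rewrite !inE eqxx orbT.
have be : basis_of fullv e.
  apply: free_basis7 => k1 k2 k3 k4 k5 k6 k7 E.
  have L x := congr1 (fun s => lie s x) E.
  move: (L v) (L w) (L a) (L c); rewrite !lieDl !lieZl !lie0l !liexx !z6c !z7c.
  rewrite av va ua cw wc ca wa cv uv wv uc ac vc aw vw uw !scaler0 !addr0 !add0r.
  move=> /eqP; rewrite scaler_eq0 oppr_eq0 (negPf z60) orbF => /eqP ->.
  move=> /eqP; rewrite scaler_eq0 oppr_eq0 (negPf z70) orbF => /eqP ->.
  move=> /free_pair[-> ->] /eqP.
  by rewrite scaler_eq0 (negPf z70) orbF => /eqP ->.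
exists e => // -[i hi]; apply/funext=> y; rewrite ced_dual dcc_basis //.
rewrite /sum_lt /= av au cw ac aw vc vu vw cu uw !c6 !c7.
have cz6 : cc e i.+1 z6 = (i == 5)%:R.
  by rewrite -eqSS -(cc_basis (i := i.+1) (j := 5) be hi isT).
have cz7 : cc e i.+1 z7 = (i == 6)%:R.
  by rewrite -eqSS -(cc_basis (i := i.+1) (j := 6) be hi isT).
rewrite !ccN !cc0 cz6 cz7 (tnth_nth 0) /= {cz6 cz7}.
have fy0 : (0 : ('I_2 -> g) -> R) y = 0 by [].
move: i hi => [|[|[|[|[|[|[|i]]]]]]] hi //=; rewrite ?fy0 ?fctE ?dual2_minor; ring.
Qed.

Lemma is_27B_brackets :
  lie a v = - z6 -> lie c u = - z6 -> lie a w = - z7 -> lie v c = - z7 ->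
  lie a c = 0 -> lie a u = 0 -> lie v u = 0 -> lie v w = 0 ->
  lie c w = 0 -> lie u w = 0 -> is_27B g.
Proof.
move=> av cu aw vc ac au vu vw cw uw.
have c6 x : lie x z6 = 0 by exact: lie_central.
have c7 x : lie x z7 = 0 by exact: lie_central.
have [va ua] : lie v a = z6 /\ lie u a = 0 by rewrite (lieN v) (lieN u) av au opprK oppr0.
have [wa uc] : lie w a = z7 /\ lie u c = z6 by rewrite (lieN w) (lieN u) aw cu !opprK.
have [ca cv] : lie c a = 0 /\ lie c v = z7 by rewrite !(lieN c) ac vc opprK oppr0.
have [uv wv] : lie u v = 0 /\ lie w v = 0 by rewrite (lieN u) (lieN w) vu vw oppr0.
have [wc wu] : lie w c = 0 /\ lie w u = 0 by rewrite !(lieN w) cw uw oppr0.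
have z60 : z6 != 0 by apply: (free_not0 fz); rewrite mem_head.
have z70 : z7 != 0 by apply: (free_not0 fz); rewrite !inE eqxx orbT.
have be : basis_of fullv e.
  apply: free_basis7 => k1 k2 k3 k4 k5 k6 k7 E.
  have L x := congr1 (fun s => lie s x) E.
  move: (L w) (L u) (L a) (L c); rewrite !lieDl !lieZl !lie0l !liexx !z6c !z7c.
  rewrite aw vw cw uw au vu cu wu va ca ua wa ac vc uc wc !scaler0 !addr0 !add0r.
  move=> /eqP; rewrite scaler_eq0 oppr_eq0 (negPf z70) orbF => /eqP ->.
  move=> /eqP; rewrite scaler_eq0 oppr_eq0 (negPf z60) orbF => /eqP ->.
  move=> /free_pair[-> ->]; rewrite scale0r add0r => /eqP.
  by rewrite scaler_eq0 (negPf z60) orbF => /eqP ->.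
exists e => // -[i hi]; apply/funext=> y; rewrite ced_dual dcc_basis //.
rewrite /sum_lt /= av cu aw vc ac au vu vw cw uw !c6 !c7.
have cz6 : cc e i.+1 z6 = (i == 5)%:R.
  by rewrite -eqSS -(cc_basis (i := i.+1) (j := 5) be hi isT).
have cz7 : cc e i.+1 z7 = (i == 6)%:R.
  by rewrite -eqSS -(cc_basis (i := i.+1) (j := 6) be hi isT).
rewrite !ccN !cc0 cz6 cz7 (tnth_nth 0) /= {cz6 cz7}.
have fy0 : (0 : ('I_2 -> g) -> R) y = 0 by [].
move: i hi => [|[|[|[|[|[|[|i]]]]]]] hi //=; rewrite ?fy0 ?fctE ?dual2_minor; ring.
Qed.

End Brackets.

End Classification.

Section DimensionTwoCenter.
Variables (R : realType) (g : lieAlgebraType R).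
Implicit Types x y z v w : g.

Lemma dimv_add_line (U : {vspace g}) v : v \notin U ->
  \dim (U + <[v]>) = (\dim U).+1.
Proof.
move=> vU; have v0 : v != 0 by apply: contraNneq vU => ->; apply: mem0v.
rewrite dimv_disjoint_sum ?dim_vline ?v0 ?addn1 //.
apply/eqP; rewrite -subv0; apply/subvP=> w; rewrite memv_cap memv0.
move=> /andP[wU /vlineP[c E]]; rewrite E scaler_eq0 (negPf v0) orbF.
apply: contraNT vU => c0; rewrite -[v](scalerK c0) -E; exact: memvZ.
Qed.

Lemma ex_notin (U V : {vspace g}) : (\dim U < \dim V)%N ->
  exists2 v, v \in V & v \notin U.
Proof.
move=> lt; have /subvPn[v vV vU] : ~~ (V <= U)%VS.
  by apply: contraTN lt => /dimvS; rewrite -leqNgt.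
by exists v.
Qed.

(** Here [c] spans the kernel of [p] on the plane. The final alternative is whether p and q are
    independent, with a dual basis, or proportional, with a common kernel. *)
Lemma two_functionals (C : {vspace g}) (p q : {scalar g}) :
  \dim C = 2 -> (exists2 x, x \in C & p x != 0) -> (exists2 x, x \in C & q x != 0) ->
  exists a c, [/\ forall x, x \in C -> exists s t, x = s *: a + t *: c,
    p a = 1, p c = 0 & (q a = 0 /\ q c = 1) \/ (q a != 0 /\ q c = 0)].
Proof.
move=> dC [x xC px] [x' x'C qx'].
have [a aC pa] : exists2 a, a \in C & p a = 1.
  by exists ((p x)^-1 *: x); rewrite ?memvZ // linearZ /= mulVf.
have a0 : a != 0 by apply: contra_eq_neq pa => ->; rewrite linear0 eq_sym oner_eq0.
have [y yC ya] : exists2 y, y \in C & y \notin <[a]>%VS.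
  by apply: ex_notin; rewrite dC dim_vline a0.
have [c [pc CE]] : exists c, p c = 0 /\ forall t, t \in C -> exists s k, t = s *: a + k *: c.
  exists (y - p y *: a); split; first by rewrite linearB linearZ /= pa mulr1 subrr.
  move=> t tC; have : t \in (<[a]> + <[y]>)%VS.
    suff -> : (<[a]> + <[y]>)%VS = C by [].
    apply/eqP; rewrite eqEdim subv_add -!memvE aC yC dC /=.
    by rewrite dimv_add_line // dim_vline a0.
  move=> /memv_addP[_ /vlineP[s ->] [_ /vlineP[k ->] ->]].
  exists (s + k * p y), k; rewrite scalerBr scalerDl scalerA -addrA; congr (_ + _).
  by rewrite [RHS]addrC subrK.
have [qc|qc] := eqVneq (q c) 0.
  exists a, c; split=> //; right; split=> //.
  apply: contra qx' => /eqP qa; have [s [k ->]] := CE _ x'C.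
  by rewrite linearD !linearZ /= qa qc !mulr0 addr0.
exists (a - (q a / q c) *: c), ((q c)^-1 *: c); split.
- move=> t /CE[s [k ->]]; exists s, (s * q a + k * q c).
  rewrite scalerBr !scalerA -addrA -scaleNr -scalerDl; congr (_ + _ *: _).
  by rewrite mulrDl mulfK // mulrA addKr.
- by rewrite linearB linearZ /= pa pc mulr0 subr0.
- by rewrite linearZ /= pc mulr0.
- by left; rewrite linearB !linearZ /= divfK // subrr mulVf.
Qed.

Lemma dim_lker_line (f : 'End(g)) z : (forall x, f x \in <[z]>%VS) ->
  (\dim {:g} <= (\dim (lker f)).+1)%N.
Proof.
move=> fz; rewrite -(limg_ker_dim f fullv) capfv -addn1 leq_add2l.
apply: leq_trans (dimvS _) (_ : \dim <[z]> <= 1)%N; last by rewrite dim_vline leq_b1.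
by apply/subvP=> _ /memv_imgP[x _ ->].
Qed.

End DimensionTwoCenter.

Section Pencil.
Variables (R : realType) (g : lieAlgebraType R).
Implicit Types x y z v w : g.

Lemma free2P x y : (forall s t : R, s *: x + t *: y = 0 -> s = 0 /\ t = 0) ->
  free [:: x; y].
Proof.
move=> h; have /freeP : forall k : 'I_2 -> R,
    \sum_(i < 2) k i *: [tuple x; y]`_i = 0 -> forall i, k i = 0.
  move=> k; rewrite !big_ord_recl big_ord0 /= addr0 => /h[k0 k1].
  by move=> [[|[|i]] hi] //; [rewrite -k0|rewrite -k1]; congr k; exact: val_inj.
by [].
Qed.

Lemma free2_mul x y (a b c d : R) : a * d - b * c != 0 -> free [:: x; y] ->
  free [:: a *: x + b *: y; c *: x + d *: y].
Proof.
move=> D0 fxy; apply: free2P => s t.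
rewrite !scalerDr !scalerA addrACA -!scalerDl => /(free_pair fxy)[E1 E2].
split; apply: (mulIf D0); rewrite mul0r.
  transitivity ((s * a + t * c) * d - (s * b + t * d) * c); first by ring.
  by rewrite E1 E2 !mul0r subrr.
transitivity ((s * b + t * d) * a - (s * a + t * c) * b); first by ring.
by rewrite E1 E2 !mul0r subrr.
Qed.

Variables (a c v w u z1 z2 : g).
Hypothesis d7 : \dim {:g} = 7%N.
Hypothesis z1c : forall x, lie z1 x = 0.
Hypothesis z2c : forall x, lie z2 x = 0.
Hypothesis fz : free [:: z1; z2].
Hypotheses (va : lie v a = z2) (vw : lie v w = 0) (uv : lie u v = 0) (uw : lie u w = 0).
Hypothesis vc : lie v c = 0.

Lemma central_scale z (k : R) : (forall x, lie z x = 0) -> forall x, lie (k *: z) x = 0.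
Proof. by move=> zc x; rewrite lieZl zc scaler0. Qed.

(** Up to order, the only possibly nonzero brackets are those of a with v, u and of c with w, u. If
    [u, a] or [u, c] vanishes this is 27A, otherwise 27B; rescaling w and v matches the brackets
    that share a central direction. *)
Lemma pencil_independent (p s : R) :
  lie w c = z1 -> lie w a = 0 -> lie a c = 0 ->
  lie u a = p *: z1 -> lie u c = s *: z2 -> (p != 0) || (s != 0) ->
  is_27A g \/ is_27B g.
Proof.
move=> wc wa ac ua uc ps.
have [av au] : lie a v = - z2 /\ lie a u = - (p *: z1) by rewrite !(lieN a) va ua.
have [cw cu] : lie c w = - z1 /\ lie c u = - (s *: z2) by rewrite !(lieN c) wc uc.
have [aw cv] : lie a w = 0 /\ lie c v = 0 by rewrite (lieN a) (lieN c) wa vc oppr0.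
have [vu wu] : lie v u = 0 /\ lie w u = 0 by rewrite (lieN v) (lieN w) uv uw oppr0.
have [ca wv] : lie c a = 0 /\ lie w v = 0 by rewrite (lieN c) (lieN w) ac vw oppr0.
have z1k (k : R) := central_scale k z1c; have z2k (k : R) := central_scale k z2c.
have [s0|s0] := eqVneq s 0; [left|have [p0|p0] := eqVneq p 0; [left|right]].
- rewrite s0 scale0r oppr0 eqxx orbF in uc cu ps.
  apply: (@is_27A_brackets _ _ a v c u (p *: w) z2 (p *: z1)) => //;
    rewrite ?lieZr ?cw ?aw ?vw ?uw ?scaler0 ?scalerN //.
  by have := free2_mul (a := 0) (b := 1) (c := p) (d := 0) _ fz;
    rewrite !scale0r !scale1r add0r addr0 mul0r mul1r sub0r oppr_eq0; apply.
- rewrite p0 scale0r oppr0 in ua au.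
  apply: (@is_27A_brackets _ _ c w a u (s *: v) z1 (s *: z2)) => //;
    rewrite ?lieZr ?av ?cv ?wv ?uv ?scaler0 ?scalerN //.
  by have := free2_mul (a := 1) (b := 0) (c := 0) (d := s) _ fz;
    rewrite !scale0r !scale1r add0r addr0 !mul0r mul1r subr0; apply.
apply: (@is_27B_brackets _ _ a u c (p *: w) (- s *: v) (p *: z1) (- s *: z2)) => //;
  rewrite ?lieZr ?cw ?cv ?av ?aw ?uv ?uw ?wv ?lieZl ?lieZr ?wv ?scaler0 ?scalerN
    ?scaleNr ?opprK //.
by have := free2_mul (a := p) (b := 0) (c := 0) (d := - s) _ fz;
  rewrite !scale0r add0r addr0 !mul0r subr0 mulf_eq0 oppr_eq0 (negPf p0) (negPf s0)
    scaleNr; apply.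
Qed.

Lemma pencil_proportional (k r s : R) : k != 0 ->
  lie w c = 0 -> lie w a = k *: z1 -> lie a c = 0 ->
  lie u a = 0 -> lie u c = r *: z1 + s *: z2 -> (r != 0) || (s != 0) ->
  is_27A g.
Proof.
move=> k0 wc wa ac ua uc rs.
have [av au] : lie a v = - z2 /\ lie a u = 0 by rewrite !(lieN a) va ua oppr0.
have [cw aw] : lie c w = 0 /\ lie a w = - (k *: z1) by rewrite (lieN c) (lieN a) wc wa oppr0.
have cv : lie c v = 0 by rewrite (lieN c) vc oppr0.
have [vu wu] : lie v u = 0 /\ lie w u = 0 by rewrite (lieN v) (lieN w) uv uw oppr0.
have [ca wv] : lie c a = 0 /\ lie w v = 0 by rewrite (lieN c) (lieN w) ac vw oppr0.
(* Chosen in the span of v and w so that [a, e4] = [u, c]. *)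
pose e4 := - ((r / k) *: w + s *: v).
have [a4 [v4 [w4 [c4 u4]]]] : lie a e4 = r *: z1 + s *: z2 /\
    lie v e4 = 0 /\ lie w e4 = 0 /\ lie e4 c = 0 /\ lie u e4 = 0.
  rewrite /e4 !linearN /= !lieDr !lieZr aw av vw wv uw uv !liexx.
  rewrite !scalerN opprD !opprK scalerA divfK // !scaler0 !addr0 oppr0.
  by do ![split=> //]; rewrite lieN linearN /= lieDr !lieZr cw cv !scaler0 addr0 !oppr0.
have zc x : lie (- (r *: z1 + s *: z2)) x = 0.
  by rewrite -scaleN1r lieZl lieDl !lieZl z1c z2c !scaler0 addr0 scaler0.
(* The other central basis vector must be independent of r z1 + s z2: z2 serves if r is nonzero, and
   z1 otherwise. *)
have [r0|r0] := eqVneq r 0; last first.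
  apply: (@is_27A_brackets _ _ a v u e4 c z2 (- (r *: z1 + s *: z2))); rewrite ?opprK //.
  have := free2_mul (a := 0) (b := 1) (c := - r) (d := - s) _ fz.
  rewrite scale0r scale1r add0r !scaleNr -opprD mul0r mul1r sub0r opprK; exact.
rewrite r0 eqxx /= in rs.
have fe : free [:: z1; - (r *: z1 + s *: z2)].
  have := free2_mul (a := 1) (b := 0) (c := - r) (d := - s) _ fz.
  rewrite scale0r scale1r addr0 !scaleNr -opprD mul1r mul0r subr0 oppr_eq0; exact.
apply: (@is_27A_brackets _ _ a (k^-1 *: w) u e4 c z1 (- (r *: z1 + s *: z2)));
  rewrite ?opprK // ?lieZr ?lieZl ?aw ?wu ?w4 ?wc ?scaler0 //.
by rewrite scalerN scalerK.
Qed.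

End Pencil.

Section CenterTwo.
Variables (R : realType) (g : lieAlgebraType R).
Implicit Types x y z v w : g.

(* Bringing a pair of lifts of the basis of [g / U] into normal form only uses
   the freedom of adding elements of the abelian ideal [U]. *)
Lemma pencil_normal_form (a c v w u z1 z2 : g) (k p q r s m n : R) :
  \dim {:g} = 7%N -> (forall x, lie z1 x = 0) -> (forall x, lie z2 x = 0) ->
  free [:: z1; z2] -> lie v w = 0 -> lie u v = 0 -> lie u w = 0 ->
  lie v a = z2 -> lie v c = 0 ->
  (lie w a = 0 /\ lie w c = z1) \/ (k != 0 /\ lie w a = k *: z1 /\ lie w c = 0) ->
  lie u a = p *: z1 + q *: z2 -> lie u c = r *: z1 + s *: z2 ->
  lie a c = m *: z1 + n *: z2 ->
  (forall x y : R, lie (u + x *: v + y *: w) a <> 0 \/ lie (u + x *: v + y *: w) c <> 0) ->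
  is_27A g \/ is_27B g.
Proof.
move=> d7 z1c z2c fz vw uv uw va vc wac ua uc ac nz.
have av : lie a v = - z2 by rewrite lieN va.
have [cv wv] : lie c v = 0 /\ lie w v = 0 by rewrite (lieN c) (lieN w) vc vw oppr0.
case: wac => [[wa wc] | [k0 [wa wc]]].
  have [aw cw] : lie a w = 0 /\ lie c w = - z1 by rewrite (lieN a) (lieN c) wa wc oppr0.
  (* Removes the z2-component of [u, a] and the z1-component of [u, c]. *)
  pose u' := u + (- q) *: v + (- r) *: w.
  have u'a : lie u' a = p *: z1.
    by rewrite /u' !lieDl !lieZl ua va wa scaler0 addr0 scaleNr addrK.
  have u'c : lie u' c = s *: z2.
    by rewrite /u' !lieDl !lieZl uc vc wc scaler0 addr0 scaleNr addrC addKr.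
  have [u'v u'w] : lie u' v = 0 /\ lie u' w = 0.
    by rewrite /u' !lieDl !lieZl uv uw vw wv !liexx !scaler0 !addr0.
  (* The corrections of a by w and of c by v cancel [a, c] = m z1 + n z2. *)
  apply: (@pencil_independent _ _ (a - m *: w) (c + n *: v) v w u' z1 z2 d7
    _ _ _ _ _ _ _ _ p s) => //.
  - by rewrite lieDr linearN /= lieZr va vw scaler0 subr0.
  - by rewrite lieDr lieZr vc liexx scaler0 addr0.
  - by rewrite lieDr lieZr wc wv scaler0 addr0.
  - by rewrite lieDr linearN /= lieZr wa liexx scaler0 subr0.
  - rewrite !lieDr !lieDl -!scaleNr !lieZr !lieZl ac av wv wc scalerN scaleNr !scaler0 addr0.
    by rewrite addrAC addrK subrr.
  - by rewrite lieDr linearN /= lieZr u'a u'w scaler0 subr0.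
  - by rewrite lieDr lieZr u'c u'v scaler0 addr0.
  - rewrite -negb_and; apply/negP=> /andP[/eqP p0 /eqP s0].
    have [] := nz (- q) (- r); rewrite -/u' ?u'a ?u'c ?p0 ?s0 scale0r; exact.
left.
have [aw cw] : lie a w = - (k *: z1) /\ lie c w = 0 by rewrite (lieN a) (lieN c) wa wc oppr0.
(* Now v and w both act through a, so [u, a] can be removed entirely. *)
pose u' := u + (- q) *: v + (- (p / k)) *: w.
have u'a : lie u' a = 0.
  rewrite /u' !lieDl !lieZl ua va wa !scaleNr scalerA divfK //.
  by rewrite addrK subrr.
have u'c : lie u' c = r *: z1 + s *: z2.
  by rewrite /u' !lieDl !lieZl uc vc wc !scaler0 !addr0.
have [u'v u'w] : lie u' v = 0 /\ lie u' w = 0.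
  by rewrite /u' !lieDl !lieZl uv uw vw wv !liexx !scaler0 !addr0.
apply: (@pencil_proportional _ _ a (c + (n *: v + (m / k) *: w)) v w u' z1 z2 d7
  _ _ _ _ _ _ _ _ k r s) => //.
- by rewrite !lieDr !lieZr vc vw liexx !scaler0 !addr0.
- by rewrite !lieDr !lieZr wc wv liexx !scaler0 !addr0.
- rewrite !lieDr !lieZr ac av aw !scalerN scalerA divfK //.
  by rewrite [- _ - _]addrC addrACA !subrr addr0.
- by rewrite !lieDr !lieZr u'c u'v u'w !scaler0 !addr0.
rewrite -negb_and; apply/negP=> /andP[/eqP r0 /eqP s0].
have [] := nz (- q) (- (p / k)); rewrite -/u' ?u'a ?u'c ?r0 ?s0 ?scale0r ?addr0; exact.
Qed.

Lemma center2_27AB : \dim {:g} = 7%N -> (forall x y, lie x y \in center g) ->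
  \dim (center g) = 2%N -> is_27A g \/ is_27B g.
Proof.
move=> d7 liec dc.
have [Z ZE] : exists Z : 2.-tuple g, basis_of (center g) Z.
  exists (tcast dc (vbasis (center g))); have := vbasisP (center g).
  by rewrite !basisEdim val_tcast.
pose z1 := tnth Z ord0; pose z2 := tnth Z ord_max.
have ZE12 : Z = [:: z1; z2] :> seq g.
  rewrite /z1 /z2 !(tnth_nth 0); case: (Z) => [[|x [|y [|]]]] //.
pose al : {scalar g} := coord Z ord0; pose be : {scalar g} := coord Z ord_max.
have lieE x y : lie x y = al (lie x y) *: z1 + be (lie x y) *: z2.
  rewrite [LHS](coord_basis ZE (liec x y)) !big_ord_recl big_ord0 addr0.
  rewrite /z1 /z2 !(tnth_nth 0) /=.
  by congr (_ + coord _ _ _ *: _); apply: val_inj.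
have fz : free [:: z1; z2] by rewrite -ZE12 (basis_free ZE).
have z1c x : lie z1 x = 0 by apply/centerP: x; rewrite (basis_mem ZE) // mem_tnth.
have z2c x : lie z2 x = 0 by apply/centerP: x; rewrite (basis_mem ZE) // mem_tnth.
pose C0 := (center g)^C%VS.
have dC0 : \dim C0 = 5%N by rewrite dimv_compl d7 dc.
(* The center has a complement of odd dimension 5, on which every skew form is degenerate. *)
have rad (f : {scalar g}) : exists2 v, v \notin center g & forall x, f (lie v x) = 0.
  have oC0 : odd (\dim C0) by rewrite dC0.
  have [v [vC v0 vf]] := odd_radical f oC0.
  exists v.
    apply: contra v0 => vc; rewrite -memv0 -(capv_compl (center g)) memv_cap vc; exact: vC.
  move=> x; have /memv_addP[y /centerP yc [t tC ->]] : x \in (center g + C0)%VS.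
    by rewrite addv_complf memvf.
  by rewrite lieDr (lieN v y) yc oppr0 add0r vf.
have [v vZ val] := rad al; have [w wZ wbe] := rad be.
have vE x : lie v x = be (lie v x) *: z2 by rewrite {1}lieE val scale0r add0r.
have wE x : lie w x = al (lie w x) *: z1 by rewrite {1}lieE wbe scale0r addr0.
have vw : lie v w = 0.
  by rewrite vE [lie v w]lieN linearN /= wbe oppr0 scale0r.
have wv : lie w v = 0 by rewrite lieN vw oppr0.
have wZv : w \notin (center g + <[v]>)%VS.
  apply: contra wZ => /memv_addP[z /centerP zc [_ /vlineP[k ->] E]].
  have al0 x : al (lie w x) = 0 by rewrite E lieDl zc add0r lieZl linearZ /= val mulr0.
  by apply/centerP=> x; rewrite wE al0 scale0r.
(* Bracketing with v or with w has rank at most 1, so the two kernels meet in dimension at least 5.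
   This exceeds the dimension 4 of the span of the center, v and w, and leaves room for [u]. *)
pose fv := linfun (lie v); pose fw := linfun (lie w).
have kv : (6 <= \dim (lker fv))%N.
  rewrite -ltnS -d7 (dim_lker_line (z := z2)) // => x; rewrite lfunE /= vE memvZ ?memv_line //.
have kw : (6 <= \dim (lker fw))%N.
  rewrite -ltnS -d7 (dim_lker_line (z := z1)) // => x; rewrite lfunE /= wE memvZ ?memv_line //.
have kvw : (5 <= \dim (lker fv :&: lker fw))%N.
  have := dimv_sum_cap (lker fv) (lker fw); have := dimvS (subvf (lker fv + lker fw)).
  rewrite d7; lia.
have d3 : \dim (center g + <[v]>) = 3 by rewrite dimv_add_line ?dc.
have d4 : \dim (center g + <[v]> + <[w]>) = 4 by rewrite dimv_add_line ?d3.
have [u uK uU] : exists2 u, u \in (lker fv :&: lker fw)%VS &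
    u \notin (center g + <[v]> + <[w]>)%VS.
  by apply: ex_notin; rewrite d4.
move: uK; rewrite memv_cap !memv_ker !lfunE /= => /andP[/eqP vu /eqP wu].
have uv : lie u v = 0 by rewrite lieN vu oppr0.
have uw : lie u w = 0 by rewrite lieN wu oppr0.
(* [U] is abelian of dimension 5, so every nonzero bracket involves its 2-dimensional complement [C]
   below. *)
pose U := (center g + <[v]> + <[w]> + <[u]>)%VS.
have dU : \dim U = 5 by rewrite dimv_add_line ?d4.
have UE x : x \in U -> exists z i j k, [/\ z \in center g & x = z + i *: v + j *: w + k *: u].
  case/memv_addP=> x1 /memv_addP[x2 /memv_addP[z zc [_ /vlineP[i ->] ->]]].
  move=> [_ /vlineP[j ->] ->].
  by move=> [_ /vlineP[k ->] ->]; exists z, i, j, k.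
have comm t x : lie t v = 0 -> lie t w = 0 -> lie t u = 0 -> x \in U -> lie t x = 0.
  move=> tv tw tu /UE[z [i [j [k [/centerP zc ->]]]]].
  by rewrite !lieDr !lieZr tv tw tu lieN zc !scaler0 oppr0 !addr0.
pose C := U^C%VS.
have dC : \dim C = 2 by rewrite dimv_compl d7 dU.
have gE x : exists y t, [/\ y \in U, t \in C & x = y + t].
  have /memv_addP[y yU [t tC ->]] : x \in (U + C)%VS by rewrite addv_complf memvf.
  by exists y, t.
pose p : {scalar g} := be \o lie v; pose q : {scalar g} := al \o lie w.
have nonzero t : t \notin center g -> lie t v = 0 -> lie t w = 0 -> lie t u = 0 ->
    exists2 x, x \in C & lie t x <> 0.
  move=> tZ tv tw tu; apply: contrapT => H; case/negP: tZ; apply/centerP=> x.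
  have [y [x' [yU x'C ->]]] := gE x; rewrite lieDr (comm _ _ tv tw tu yU) add0r.
  by apply: contrapT => tx; apply: H; exists x'.
have [xv xvC vxv] := nonzero v vZ (liexx v) vw vu.
have [xw xwC wxw] := nonzero w wZ wv (liexx w) wu.
have [||a [c [CE pa pc qac]]] := @two_functionals _ _ C p q dC.
- by exists xv => //; apply: contra_notN vxv => /eqP E; rewrite vE [be _]E scale0r.
- by exists xw => //; apply: contra_notN wxw => /eqP E; rewrite wE [al _]E scale0r.
apply: (@pencil_normal_form a c v w u z1 z2 (q a) _ _ _ _ _ _ d7 z1c z2c fz vw uv uw
         _ _ _ (lieE u a) (lieE u c) (lieE a c)).
- by rewrite vE [be _]pa scale1r.
- by rewrite vE [be _]pc scale0r.
- have wac : lie w a = q a *: z1 /\ lie w c = q c *: z1 by split; exact: wE.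
  case: qac wac => [[-> ->]|[qa ->]] [-> ->]; [left|right].
    by rewrite scale0r scale1r.
  by rewrite scale0r.
move=> i j; set u' := u + _ + _.
have u'Z : u' \notin center g.
  apply: contra uU => u'c; have -> : u = u' + (- i) *: v + (- j) *: w.
    by rewrite /u' !scaleNr addrAC addrK addrK.
  by rewrite !memv_add // memvZ // memv_line.
have [x xC u'x] : exists2 x, x \in C & lie u' x <> 0.
  by apply: nonzero => //; rewrite /u' !lieDl !lieZl ?uv ?uw ?vw ?wv ?vu ?wu !liexx
    !scaler0 !addr0.
apply: contrapT => /not_orP[/contrapT u'a /contrapT u'c]; apply: u'x.
by have [s [t ->]] := CE x xC; rewrite lieDr !lieZr u'a u'c !scaler0 addr0.
Qed.

End CenterTwo.

(** * Algebras with 3-dimensional center *)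

Section SymmetricTraceless.
Variable R : realFieldType.

Lemma dot_eq0 (n : nat) (v : 'rV[R]_n) : (v *m v^T) 0 0 = 0 -> v = 0.
Proof.
rewrite mxE => s0; apply/rowP=> j; rewrite [RHS]mxE; apply/eqP; rewrite -sqrf_eq0.
have /psumr_eq0P E : forall i, true -> 0 <= v 0 i ^+ 2 by move=> i _; rewrite sqr_ge0.
by rewrite E // -[RHS]s0; apply: eq_bigr => i _; rewrite mxE expr2.
Qed.

(** If A is invertible, QA can be any invertible matrix, such as diag(1, 1, -2). If A has rank 2,
    take orthogonal u, v spanning its row space: u^T v + v^T u is symmetric, has trace 2 u.v = 0 and
    the same row space, hence is of the form QA. *)
Lemma sym_traceless_rowequiv (A : 'M[R]_3) : (2 <= \rank A)%N ->
  exists2 Q, Q \in unitmx & (Q *m A)^T = Q *m A /\ \tr (Q *m A) = 0.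
Proof.
move=> rA; have [r3|r3] := eqVneq (\rank A) 3.
  have uA : A \in unitmx by rewrite -row_free_unit -row_leq_rank r3.
  pose d : 'rV[R]_3 := \row_j (if j == ord_max then -2 else 1).
  have E : diag_mx d *m invmx A *m A = diag_mx d by rewrite mulmxKV.
  exists (diag_mx d *m invmx A); last first.
    rewrite E tr_diag_mx mxtrace_diag !big_ord_recl big_ord0 !mxE /=; split => //.
    by ring.
  rewrite unitmx_mul unitmx_inv uA andbT unitmxE det_diag unitfE.
  apply/prodf_neq0 => j _; rewrite mxE; case: ifP => _; last exact: oner_neq0.
  by rewrite oppr_eq0 pnatr_eq0.
have {r3}rA : \rank A = 2 by move: (rank_leq_row A) rA r3; case: (\rank A) => [|[|[|[|]]]].
have [B [BA fB]] : exists B : 'M[R]_(2, 3), (B :=: A)%MS /\ row_free B.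
  have := eq_row_base A; have := row_base_free A; move: (row_base A); rewrite rA => B fB BA.
  by exists B.
pose u := row ord0 B; pose b := row ord_max B.
have freeB (s t : R) : s *: u + t *: b = 0 -> s = 0 /\ t = 0.
  move=> E; pose c : 'rV[R]_2 := \row_j (if j == ord0 then s else t).
  have cB : c *m B = 0.
    rewrite -E mulmx_sum_row !big_ord_recl big_ord0 addr0 !mxE /=.
    by congr (_ + _ *: row _ _); apply: val_inj.
  have c0 : c = 0 by apply: (row_free_inj fB); rewrite cB mul0mx.
  by split; [have := congr1 (fun M : 'rV_2 => M 0 ord0) c0
            |have := congr1 (fun M : 'rV_2 => M 0 ord_max) c0]; rewrite !mxE.
pose uu := (u *m u^T) 0 0; pose bu := (b *m u^T) 0 0.
have u0 : u != 0.
  apply/eqP=> E; have [] := freeB 1 0; rewrite ?E ?scaler0 ?scale0r ?addr0 //.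
  by move=> /eqP; rewrite oner_eq0.
have uu0 : uu != 0 by apply: contra u0 => /eqP /dot_eq0 ->.
pose v := b - (bu / uu) *: u.
have v0 : v != 0.
  apply/eqP=> E; have [] := freeB (- (bu / uu)) 1; last by move=> _ /eqP; rewrite oner_eq0.
  by rewrite scale1r scaleNr addrC.
have vu : v *m u^T = 0.
  apply/matrixP=> i j; rewrite !ord1 mulmxBl -scalemxAl mxE [X in _ + X]mxE [X in _ - X]mxE.
  by rewrite -/uu -/bu divfK // subrr [RHS]mxE.
have uv : u *m v^T = 0 by rewrite -[u]trmxK -trmx_mul vu trmx0.
pose S := u^T *m v + v^T *m u.
have scal (w : 'rV[R]_3) : w *m w^T = ((w *m w^T) 0 0)%:M by rewrite [LHS]mx11_scalar.
have uS : u *m S = uu *: v.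
  by rewrite mulmxDr !mulmxA uv mul0mx addr0 scal mul_scalar_mx.
have vS : v *m S = (v *m v^T) 0 0 *: u.
  by rewrite mulmxDr !mulmxA vu mul0mx add0r -mul_scalar_mx -scal.
have vv0 : (v *m v^T) 0 0 != 0 by apply: contra v0 => /eqP /dot_eq0 ->.
have subB i : (row i B <= A)%MS by rewrite -BA row_sub.
have SA : (S == A)%MS.
  apply/andP; split.
    have vA : (v <= A)%MS by rewrite addmx_sub ?subB // -scaleNr scalemx_sub ?subB.
    by rewrite addmx_sub // mulmx_sub ?subB.
  have uleS : (u <= S)%MS by rewrite -[u](scalerK vv0) -vS scalemx_sub ?submxMl.
  have vleS : (v <= S)%MS by rewrite -[v](scalerK uu0) -uS scalemx_sub ?submxMl.
  rewrite -BA; apply/row_subP=> -[[|[|i]] hi] //.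
    by rewrite (_ : Ordinal hi = ord0) //; apply: val_inj.
  rewrite (_ : Ordinal hi = ord_max); last exact: val_inj.
  by rewrite -/b -[b](subrK ((bu / uu) *: u)) addmx_sub // scalemx_sub.
have /eqmxMunitP[Q uQ SQ] := SA.
exists Q => //; rewrite -SQ; split.
  by rewrite linearD /= !trmx_mul !trmxK addrC.
by rewrite linearD /= ![\tr (_^T *m _)]mxtrace_mulC uv vu linear0 addr0.
Qed.

(** The left kernels of A and B meet trivially, so their dimensions add up to at most m. *)
Lemma rank_sum_ge (m n p : nat) (A : 'M[R]_(m, n)) (B : 'M[R]_(m, p)) :
  (forall r : 'rV_m, r *m A = 0 -> r *m B = 0 -> r = 0) ->
  (m <= \rank A + \rank B)%N.
Proof.
move=> h; have k0 : (kermx A :&: kermx B = 0)%MS.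
  apply/eqP; rewrite -submx0; apply/rV_subP=> r; rewrite sub_capmx => /andP[].
  by move=> /sub_kermxP rA /sub_kermxP rB; rewrite (h r rA rB) sub0mx.
have := mxrank_disjoint_sum k0; rewrite !mxrank_ker => E.
have := rank_leq_col (kermx A + kermx B)%MS; rewrite E.
have := rank_leq_row A; have := rank_leq_row B; lia.
Qed.

End SymmetricTraceless.

Section CenterThree.
Variables (R : realType) (g : lieAlgebraType R).
Hypothesis d7 : \dim {:g} = 7%N.
Hypothesis lie_center : forall x y : g, lie x y \in center g.

Lemma scalar_span0 (f : {scalar g}) (X : seq g) :
  (forall x, x \in X -> f x = 0) -> forall x, x \in <<X>>%VS -> f x = 0.
Proof.
move=> fX x /(coord_span (X := in_tuple X)) ->; rewrite linear_sum big1 // => i _.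
by rewrite linearZ /= fX ?mulr0 // mem_nth.
Qed.

(* Row i pairs de^i with w_1, w_2, w_7, where h1, .., h4 stand for e_3, .., e_6.  Negating h1
   turns the self-dual part into the anti-self-dual one, up to signs. *)
Definition sd_mx (z : 'I_3 -> g -> g -> R) (h1 h2 h3 h4 : g) : 'M[R]_3 :=
  \matrix_(i, j) nth 0
    [:: - z i h1 h3 + z i h2 h4; z i h1 h4 + z i h2 h3; - z i h1 h2 - z i h3 h4] j.

Lemma center3_frame (Z : 3.-tuple g) (h1 h2 h3 h4 : g) :
  basis_of (center g) Z ->
  (fullv <= <<[:: h1; h2; h3; h4]>> + center g)%VS ->
  (2 <= \rank (sd_mx (fun i x y => coord Z i (lie x y)) h1 h2 h3 h4))%N ->
  admits_purely_coclosed_G2 g.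
Proof.
move=> bZ hh; set A := sd_mx _ _ _ _ _ => rA.
have [Q uQ [QA trQA]] := sym_traceless_rowequiv rA.
(* A basis changes contragrediently to its coordinates: with [invmx Q] here, the coordinates with
   respect to [y] are the functionals [s] given by the rows of Q, and A becomes QA. *)
pose y (i : 'I_3) := \sum_l invmx Q l i *: Z`_l.
pose s (i : 'I_3) (x : g) := \sum_k Q i k * coord Z k x.
have zE x : x \in center g -> x = \sum_i s i x *: y i.
  move=> xc; rewrite [LHS](coord_basis bZ xc).
  under [RHS]eq_bigr do rewrite scaler_sumr.
  rewrite exchange_big /=; apply: eq_bigr => l _.
  under eq_bigr do rewrite scalerA.
  rewrite -scaler_suml; congr (_ *: _).
  pose c : 'cV[R]_3 := \col_k coord Z k x.
  have := congr1 (fun M : 'cV_3 => M l 0) (mulKmx uQ c); rewrite !mxE => <-.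
  apply: eq_bigr => i _; rewrite mulrC mxE /s; congr (_ * _).
  by apply: eq_bigr => k _; rewrite mxE.
have yc i : y i \in center g.
  by rewrite memv_suml // => l _; rewrite memvZ // (basis_mem bZ) // mem_nth // size_tuple.
have ylie i x : lie (y i) x = 0 by apply/centerP: x.
have liey i x : lie x (y i) = 0 by rewrite lieN ylie oppr0.
pose i2 : 'I_3 := lift ord0 (lift ord0 ord0).
pose e : 7.-tuple g := [tuple y ord0; y (lift ord0 ord0); h1; h2; h3; h4; y i2].
have be : basis_of fullv e.
  rewrite basisEdim size_tuple d7 leqnn andbT; apply: subv_trans hh _.
  rewrite subv_add; apply/andP; split.
    by apply: sub_span => x; rewrite !inE => /or4P[] /eqP->; rewrite eqxx ?orbT.
  apply/subvP=> x /zE ->; rewrite !big_ord_recl big_ord0 addr0.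
  by rewrite !memvD // memvZ // memv_span // !inE eqxx ?orbT.
have ccE k x : (0 < k <= 7)%N -> x \in center g -> cc e k x =
    s ord0 x * (k == 1)%:R + s (lift ord0 ord0) x * (k == 2)%:R + s i2 x * (k == 7)%:R.
  move=> hk xc; rewrite [x in LHS](zE x xc) /cc linear_sum !big_ord_recl big_ord0.
  rewrite addr0 /= addrA.
  rewrite !linearZ /=; congr (_ * _ + _ * _ + _ * _).
  - exact: (cc_basis (j := 0) be hk isT).
  - exact: (cc_basis (j := 1) be hk isT).
  - exact: (cc_basis (j := 6) be hk isT).
pose D i p q := - cc e i (lie e`_p.-1 e`_q.-1).
have sA i : [/\ (Q *m A) i ord0 = - s i (lie h1 h3) + s i (lie h2 h4),
    (Q *m A) i (lift ord0 ord0) = s i (lie h1 h4) + s i (lie h2 h3) &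
    (Q *m A) i i2 = - s i (lie h1 h2) - s i (lie h3 h4)].
  by rewrite /s !mxE !big_ord_recl !big_ord0 !mxE /=; split; ring.
have sym i j : (Q *m A) i j = (Q *m A) j i.
  by move/matrixP: QA => /(_ j i) <-; rewrite [RHS]mxE.
have [s00 s01 s02] := sA ord0; have [s10 s11 s12] := sA (lift ord0 ord0).
have [s20 s21 s22] := sA i2.
apply: (@purely_coclosed_37 _ _ D e be).
- move=> i x z hi; rewrite dcc_basis // /sum_lt /= !ylie !liey !cc0 /de_37.
  case: ifP => [_|]; first by rewrite /D /=; ring.
  rewrite !inE => /negbT; rewrite !negb_or => /and3P[n1 n2 n7].
  by rewrite !ccE // (negPf n1) (negPf n2) (negPf n7) /=; ring.
- have := sym ord0 (lift ord0 ord0).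
  by rewrite s01 s10 /D /= !ccE //= => E; lra.
- have := sym ord0 i2.
  by rewrite s02 s20 /D /= !ccE //= => E; lra.
- have := sym (lift ord0 ord0) i2.
  by rewrite s12 s21 /D /= !ccE //= => E; lra.
move: trQA; rewrite /mxtrace !big_ord_recl big_ord0 s00 s11 s22.
by rewrite /D /= !ccE //= => E; lra.
Qed.

Lemma center3_purely_coclosed : \dim (center g) = 3 -> center g = derived g ->
  admits_purely_coclosed_G2 g.
Proof.
move=> dc cd.
have [Z bZ] : exists Z : 3.-tuple g, basis_of (center g) Z.
  exists (tcast dc (vbasis (center g))); have := vbasisP (center g).
  by rewrite !basisEdim val_tcast.
have dC : \dim (center g)^C = 4 by rewrite dimv_compl d7 dc.
have [H bH] : exists H : 4.-tuple g, basis_of (center g)^C H.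
  exists (tcast dC (vbasis (center g)^C)); have := vbasisP (center g)^C.
  by rewrite !basisEdim val_tcast.
case: H bH => [[|h1 [|h2 [|h3 [|h4 [|]]]]]] //= sH bH.
have hh : (fullv <= <<[:: h1; h2; h3; h4]>> + center g)%VS.
  by rewrite (span_basis bH) addvC addv_complf.
pose z (i : 'I_3) x y := coord Z i (lie x y).
(* Suppose a row r is killed by both matrices, and let f be the functional with coefficients r. The
   self-dual and anti-self-dual equations together force all six f([h_i, h_j]) to vanish. The center
   is spanned by brackets, so f is zero on it and r = 0. *)
have : (3 <= \rank (sd_mx z h1 h2 h3 h4) + \rank (sd_mx z (- h1) h2 h3 h4))%N.
  apply: rank_sum_ge => r rA rB.
  have fl : scalar (fun x : g => \sum_i r 0 i * coord Z i x).
    move=> a x y; rewrite mulr_sumr -big_split; apply: eq_bigr => i _.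
    by rewrite linearD linearZ /= mulrDr mulrCA.
  have [f fE] : exists f : {scalar g}, forall x, f x = \sum_i r 0 i * coord Z i x.
    pose f0 : {scalar g} := HB.pack (fun x : g => \sum_i r 0 i * coord Z i x)
      (GRing.isLinear.Build R g R *%R _ fl).
    by exists f0.
  have flN x y : f (lie (- x) y) = - f (lie x y).
    by rewrite -[- x]scaleN1r lieZl scaleN1r linearN.
  have colE k1 : [/\ (r *m sd_mx z k1 h2 h3 h4) 0 ord0 = - f (lie k1 h3) + f (lie h2 h4),
      (r *m sd_mx z k1 h2 h3 h4) 0 (lift ord0 ord0) = f (lie k1 h4) + f (lie h2 h3) &
      (r *m sd_mx z k1 h2 h3 h4) 0 (lift ord0 (lift ord0 ord0)) =
        - f (lie k1 h2) - f (lie h3 h4)].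
    by rewrite !fE !mxE !big_ord_recl !big_ord0 !mxE /=; split; ring.
  have [a0 a1 a2] := colE h1; have [b0 b1 b2] := colE (- h1).
  rewrite rA !mxE in a0 a1 a2; rewrite rB !mxE !flN in b0 b1 b2.
  have hlie x y : x \in [:: h1; h2; h3; h4] -> y \in [:: h1; h2; h3; h4] -> f (lie x y) = 0.
    have fN u v : f (lie u v) = - f (lie v u) by rewrite lieN linearN.
    rewrite !inE => /or4P[] /eqP-> /or4P[] /eqP->;
      rewrite ?liexx ?linear0 // ?(fN h2 h1) ?(fN h3 h1) ?(fN h4 h1) ?(fN h3 h2)
        ?(fN h4 h2) ?(fN h4 h3); lra.
  have vanish (k : {scalar g}) : (forall x, x \in [:: h1; h2; h3; h4] -> k x = 0) ->
      (forall x, x \in center g -> k x = 0) -> forall x, k x = 0.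
    move=> kh kc x; have /memv_addP[x1 x1h [x2 x2c ->]] := subvP hh _ (memvf x).
    by rewrite linearD /= (kc x2) // addr0; apply: (scalar_span0 kh).
  have hlie2 x y : x \in [:: h1; h2; h3; h4] -> f (lie x y) = 0.
    move=> xh; apply: (vanish (f \o lie x)) => t => [|/centerP tc] /=; first exact: hlie.
    by rewrite lieN tc oppr0 linear0.
  have hlie3 x y : f (lie x y) = 0.
    rewrite lieN linearN /=; apply/eqP; rewrite oppr_eq0; apply/eqP.
    apply: (vanish (f \o lie y)) => t => [th|/centerP tc] /=.
      by rewrite lieN linearN /= hlie2 // oppr0.
    by rewrite lieN tc oppr0 linear0.
  have f0 x : x \in center g -> f x = 0.
    rewrite cd; apply: scalar_span0 => _ /allpairsP[[u v] /= [_ _ ->]]; exact: hlie3.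
  apply/rowP=> j; have := f0 Z`_j; rewrite mxE fE (bigD1 j) //= big1.
    rewrite (coord_free j j (basis_free bZ)) eqxx mulr1 addr0; apply.
    by rewrite (basis_mem bZ) // mem_nth // size_tuple.
  move=> i ij; rewrite (coord_free j i (basis_free bZ)).
  by rewrite ?[_ == i]eq_sym ?(negPf ij) mulr0.
case: (leqP 2 (\rank (sd_mx z h1 h2 h3 h4))) => [r2 _|r1 r3].
  exact: center3_frame bZ hh r2.
have r2 : (1 < \rank (sd_mx z (- h1) h2 h3 h4))%N.
  by move: r1 r3; move: (\rank _) (\rank _) => k l; lia.
apply: (@center3_frame Z (- h1) h2 h3 h4 bZ _ r2).
apply: subv_trans hh _; rewrite addvS //.
apply/span_subvP=> x; rewrite !inE => /or4P[] /eqP->.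
- by rewrite -memvN memv_span // mem_head.
- by rewrite memv_span // !inE eqxx orbT.
- by rewrite memv_span // !inE eqxx !orbT.
- by rewrite memv_span // !inE eqxx !orbT.
Qed.
End CenterThree.

(** * Algebras with 1-dimensional center *)

Section CenterOne.
Variables (R : realType) (g : lieAlgebraType R).
Hypothesis d7 : \dim {:g} = 7%N.
Variable z : g.
Hypothesis zc : center g = <[z]>%VS.
Hypothesis z0 : z != 0.
Hypothesis lie_z : forall x y : g, lie x y \in <[z]>%VS.

Lemma lie_partner (x : g) : x \notin center g -> exists y, lie x y = z.
Proof.
move=> xc; have [y xy] : exists y, lie x y <> 0.
  apply: contrapT => H; case/negP: xc; apply/centerP=> y.
  by apply: contrapT => xy; apply: H; exists y.
have /vlineP[k E] := lie_z x y.
have k0 : k != 0 by apply: contra_notN xy => /eqP k0; rewrite E k0 scale0r.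
by exists (k^-1 *: y); rewrite lieZr E scalerK.
Qed.

Definition ann (x : g) : {vspace g} := lker (linfun (lie x)).

Lemma annP (x y : g) : reflect (lie x y = 0) (y \in ann x).
Proof. by rewrite memv_ker lfunE; apply: eqP. Qed.

Lemma dim_ann_cap (U : {vspace g}) x : (\dim U <= (\dim (U :&: ann x)).+1)%N.
Proof.
have dx := dim_lker_line (f := linfun (lie x)) (z := z).
have {}dx : (\dim {:g} <= (\dim (ann x)).+1)%N by apply: dx => y; rewrite lfunE; apply: lie_z.
have := dimv_sum_cap U (ann x); have := dimvS (subvf (U + ann x)).
move: dx; rewrite d7; lia.
Qed.

Lemma lie_pair (U : {vspace g}) : (1 < \dim U)%N ->
  exists2 x, x \in U & exists y, lie x y = z.
Proof.
move=> dU; have [x xU xc] : exists2 x, x \in U & x \notin center g.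
  by apply: ex_notin; rewrite zc dim_vline z0.
by exists x => //; apply: lie_partner.
Qed.

(** Symplectic Gram-Schmidt: each new pair is taken in the common annihilator of the previous ones.
    The successive dimensions are at least 7, 5 and 3, so a noncentral vector is always
    available. *)
Lemma center1_purely_coclosed : admits_purely_coclosed_G2 g.
Proof.
have zC x : lie z x = 0 by apply/centerP: x; rewrite zc memv_line.
have zNC x : lie (- z) x = 0 by rewrite -scaleN1r lieZl zC scaler0.
have [x1 _ [y1 xy1]] : exists2 x, x \in {:g}%VS & exists y, lie x y = z.
  by apply: lie_pair; rewrite d7.
pose K1 := (fullv :&: ann x1 :&: ann y1)%VS.
have dK1 : (5 <= \dim K1)%N.
  have := dim_ann_cap fullv x1; have := dim_ann_cap (fullv :&: ann x1) y1.
  by rewrite d7 -/K1; lia.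
have [x2 x2K [t2 xt2]] : exists2 x, x \in K1 & exists y, lie x y = z by apply: lie_pair; lia.
have yx1 : lie y1 x1 = - z by rewrite lieN xy1.
(* A partner found anywhere in g is moved into [K1] by adding multiples of x1 and y1, which leaves
   its bracket with x2 unchanged. *)
have proj1 t : exists2 y, y \in K1 & exists i j, y = t + i *: x1 + j *: y1.
  have /vlineP[i E1] := lie_z x1 t; have /vlineP[j E2] := lie_z y1 t.
  exists (t + j *: x1 + (- i) *: y1); last by exists j, (- i).
  rewrite /K1 !memv_cap memvf /=; apply/andP; split; apply/annP; rewrite !lieDr !lieZr.
    by rewrite liexx scaler0 addr0 xy1 E1 scaleNr subrr.
  by rewrite liexx scaler0 addr0 yx1 E2 scalerN subrr.
move: x2K; rewrite /K1 !memv_cap => /andP[/andP[_ /annP x12] /annP y1x2].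
have x21 : lie x2 x1 = 0 by rewrite lieN x12 oppr0.
have x2y1 : lie x2 y1 = 0 by rewrite lieN y1x2 oppr0.
have [y2 y2K [i [j y2E]]] := proj1 t2.
have xy2 : lie x2 y2 = z by rewrite y2E !lieDr !lieZr xt2 x21 x2y1 !scaler0 !addr0.
move: y2K; rewrite /K1 !memv_cap => /andP[/andP[_ /annP x1y2] /annP y12].
have yx2 : lie y2 x2 = - z by rewrite lieN xy2.
pose K2 := (K1 :&: ann x2 :&: ann y2)%VS.
have dK2 : (3 <= \dim K2)%N.
  by have := dim_ann_cap K1 x2; have := dim_ann_cap (K1 :&: ann x2) y2; rewrite -/K2; lia.
have [x3 x3K [t3 xt3]] : exists2 x, x \in K2 & exists y, lie x y = z by apply: lie_pair; lia.
have proj2 t : t \in K1 -> exists2 y, y \in K2 & exists i j, y = t + i *: x2 + j *: y2.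
  move=> tK; have /vlineP[k E1] := lie_z x2 t; have /vlineP[l E2] := lie_z y2 t.
  exists (t + l *: x2 + (- k) *: y2); last by exists l, (- k).
  rewrite /K2 memv_cap memv_cap; apply/andP; split; last first.
    by apply/annP; rewrite !lieDr !lieZr liexx scaler0 addr0 yx2 E2 scalerN subrr.
  apply/andP; split.
    move: tK; rewrite /K1 !memv_cap !memvf /= => /andP[/annP a /annP b].
    by apply/andP; split; apply/annP; rewrite !lieDr !lieZr ?a ?b ?x12 ?x1y2 ?y1x2 ?y12
      !scaler0 !addr0.
  by apply/annP; rewrite !lieDr !lieZr liexx scaler0 addr0 xy2 E1 scaleNr subrr.
move: x3K; rewrite /K2 /K1 !memv_cap.
move=> /andP[/andP[/andP[/andP[_ /annP x13] /annP y1x3] /annP x23] /annP y2x3].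
have x31 : lie x3 x1 = 0 by rewrite lieN x13 oppr0.
have x3y1 : lie x3 y1 = 0 by rewrite lieN y1x3 oppr0.
have x32 : lie x3 x2 = 0 by rewrite lieN x23 oppr0.
have x3y2 : lie x3 y2 = 0 by rewrite lieN y2x3 oppr0.
have [s3 s3K [k [l s3E]]] := proj1 t3.
have [y3 y3K [m [n y3E]]] := proj2 s3 s3K.
have xy3 : lie x3 y3 = z.
  by rewrite y3E s3E !lieDr !lieZr xt3 x31 x3y1 x32 x3y2 !scaler0 !addr0.
move: y3K; rewrite /K2 /K1 !memv_cap.
move=> /andP[/andP[/andP[/andP[_ /annP x1y3] /annP y13] /annP x2y3] /annP y23].
(* The factor -2 on y3 produces the coefficient of e^56 in [de_17]; the last vector is -z because
   de^7 is minus the bracket. *)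
pose e : 7.-tuple g := [tuple x1; y1; x2; y2; x3; (-2) *: y3; - z].
have y2y1 : lie y2 y1 = 0 by rewrite lieN y12 oppr0.
have y2x1 : lie y2 x1 = 0 by rewrite lieN x1y2 oppr0.
have [y3y1 y3x1] : lie y3 y1 = 0 /\ lie y3 x1 = 0 by rewrite !(lieN y3) y13 x1y3 oppr0.
have [y3y2 y3x2] : lie y3 y2 = 0 /\ lie y3 x2 = 0 by rewrite !(lieN y3) y23 x2y3 oppr0.
have yx3 : lie y3 x3 = - z by rewrite lieN xy3.
have be : basis_of fullv e.
  apply: basis7 => // k1 k2 k3 k4 k5 k6 k7 E.
  have L x := congr1 (fun s => lie s x) E.
  move: (L y1) (L x1) (L y2) (L x2) (L y3) (L x3).
  rewrite !lieDl !lieZl !lie0l !liexx xy1 yx1 xy2 yx2 xy3 yx3 !zNC.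
  rewrite x12 y1x2 x21 x2y1 x1y2 y12 x13 y1x3 x23 y2x3 x31 x3y1 x32 x3y2.
  rewrite x1y3 y13 x2y3 y23 y2y1 y2x1 y3y1 y3x1 y3y2 y3x2 !scaler0 !addr0 !add0r.
  have kz (t : R) : t *: z = 0 -> t = 0.
    by move/eqP; rewrite scaler_eq0 (negPf z0) orbF => /eqP.
  have kNz (t : R) : t *: - z = 0 -> t = 0.
    by move/eqP; rewrite scaler_eq0 oppr_eq0 (negPf z0) orbF => /eqP.
  move=> /kz e1 /kNz e2 /kz e3 /kNz e4 /kz e5; rewrite scalerA => /kNz/eqP.
  rewrite mulf_eq0 oppr_eq0 pnatr_eq0 orbF => /eqP e6.
  by move: E; rewrite e1 e2 e3 e4 e5 e6 !scale0r !add0r => /kNz ->.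
apply: (purely_coclosed_17 be) => t x y ht.
have ez : cc e t z = - (t == 7)%:R by rewrite -(cc_basis (j := 6) be ht isT) /= ccN opprK.
have e2z : cc e t (lie x3 (-2 *: y3)) = 2 * (t == 7)%:R.
  by rewrite lieZr xy3 /cc linearZ /= -/(cc e t z) ez; ring.
rewrite dcc_basis // /sum_lt /= e2z !lieZr !lieZl !(lie_central _ zNC).
rewrite xy1 xy2 x12 y1x2 x1y2 y12 x13 y1x3 x23 y2x3 x1y3 y13 x2y3 y23.
rewrite !scaler0 !cc0 ez /de_17; case: ifP => /= _; ring.
Qed.

End CenterOne.

(** * The exceptional algebras *)

Section Exceptional.
Variables (R : realType) (g : lieAlgebraType R).

(** If the center had dimension at least 4, the bracket would factor through a quotient of dimension
    at most 3, whose three basic brackets span at most dimension 3; but they span [g, g], which is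
    the center. *)
Lemma center_le3 : (forall x y : g, lie x y \in center g) -> center g = derived g ->
  \dim {:g} = 7%N -> (\dim (center g) <= 3)%N.
Proof.
move=> liec cd d7; rewrite leqNgt; apply/negP=> k4.
pose H := vbasis (center g)^C.
have dC : (\dim (center g)^C <= 3)%N by rewrite dimv_compl d7; lia.
(* If the complement has dimension less than 3, the missing entries of [H] are the default 0 and do
   no harm. *)
pose S := <<[:: lie H`_0 H`_1; lie H`_0 H`_2; lie H`_1 H`_2]>>%VS.
have HS i j : (i < 3)%N -> (j < 3)%N -> lie H`_i H`_j \in S.
  have S01 : lie H`_0 H`_1 \in S by rewrite memv_span // !inE eqxx.
  have S02 : lie H`_0 H`_2 \in S by rewrite memv_span // !inE eqxx orbT.
  have S12 : lie H`_1 H`_2 \in S by rewrite memv_span // !inE eqxx !orbT.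
  case: i j => [|[|[|i]]] [|[|[|j]]] // _ _; rewrite ?liexx ?mem0v //.
  - by rewrite lieN memvN.
  - by rewrite lieN memvN.
  - by rewrite lieN memvN.
have split_center x : exists2 u, u \in (center g)^C%VS & forall y, lie x y = lie u y.
  have /memv_addP[c /centerP cc [u uC ->]] : x \in (center g + (center g)^C)%VS.
    by rewrite addv_complf memvf.
  by exists u => // y; rewrite lieDl cc add0r.
have : (center g <= S)%VS.
  rewrite cd; apply: derived_sub => x y.
  have [u uC ->] := split_center x; have [w wC E] := split_center y.
  rewrite lieN memvN E (coord_vbasis uC) (coord_vbasis wC) lie_suml memv_suml // => i _.
  rewrite linear_sum memv_suml // => j _; rewrite /= lieZl lieZr !memvZ //.
  by apply: HS; apply: leq_trans (ltn_ord _) dC.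
move=> /dimvS le; have := leq_trans le (dim_span _); rewrite /= leqNgt => /negP; apply.
exact: k4.
Qed.

Lemma admits_not_27AB : \dim {:g} = 7%N -> indecomposable g -> two_step_nilpotent g ->
  ~ is_27A g -> ~ is_27B g -> admits_purely_coclosed_G2 g.
Proof.
move=> d7 ind ts nA nB; have cd := center_derived ind ts.
have liec x y : lie x y \in center g by rewrite cd lie_derived.
have := center_le3 liec cd d7.
case E : (\dim (center g)) => [|[|[|[|k]]]] // _.
- case: ts => -[x [y]] xy _; case: xy; apply/eqP; rewrite -memv0.
  by move/eqP: E; rewrite dimv_eq0 => /eqP <-.
- pose z := vpick (center g).
  have z0 : z != 0 by rewrite vpick0 -dimv_eq0 E.
  have zc : center g = <[z]>%VS.
    by apply/esym/eqP; rewrite eqEdim -memvE memv_pick E dim_vline z0.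
  by apply: (center1_purely_coclosed d7 zc z0) => x y; rewrite -zc.
- by case: (center2_27AB d7 liec E).
exact: center3_purely_coclosed.
Qed.

Definition pair_fun (x y : g) : 'I_2 -> g := fun j => if j == ord0 then x else y.

Lemma structure_lie (e : 7.-tuple g) de x y (i : 'I_7) : structure_equations e de ->
  cc e i.+1 (lie x y) = - tnth de i (pair_fun x y).
Proof. by move=> /(_ i) <-; rewrite ced_dual opprK. Qed.

(** The part common to 27A and 27B: the hypotheses identify the center with the span of the last two
    basis vectors. *)
Lemma not_coclosed_center_last_two (e : 7.-tuple g) : basis_of fullv e ->
  (forall i x y, (0 < i <= 5)%N -> cc e i (lie x y) = 0) ->
  (forall x, lie e`_5 x = 0) -> (forall x, lie e`_6 x = 0) ->
  (forall i x, (forall y, lie x y = 0) -> (0 < i <= 5)%N -> cc e i x = 0) ->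
  (exists x y : g, lie x y <> 0) ->
  [/\ indecomposable g, two_step_nilpotent g & ~ admits_purely_coclosed_G2 g].
Proof.
move=> be cl e5 e6 cen ne.
have d7 : \dim {:g} = 7%N by rewrite -(span_basis be) (eqP (basis_free be)) size_tuple.
have spanE x : (forall i, (0 < i <= 5)%N -> cc e i x = 0) -> x \in <<[:: e`_5; e`_6]>>%VS.
  move=> x0; rewrite (coord_basis be (memvf x)) memv_suml // => i _.
  have [i5|i5] := ltnP i 5.
    by have := x0 i.+1 i5; rewrite /cc /= inord_val => ->; rewrite scale0r mem0v.
  rewrite memvZ // memv_span // !inE; case: i i5 => [[|[|[|[|[|[|[|i]]]]]]] hi] //= _;
    by rewrite eqxx ?orbT.
have cE : center g = <<[:: e`_5; e`_6]>>%VS.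
  apply: subv_anti; apply/andP; split.
    by apply/subvP=> x /centerP xc; apply: spanE => i hi; apply: cen.
  by apply/span_subvP=> x; rewrite !inE => /orP[] /eqP->; apply/centerP.
have fe : free [:: e`_5; e`_6].
  have := basis_free be; rewrite -(cat_take_drop 5 e) => /catr_free.
  by case: (e) => [[|? [|? [|? [|? [|? [|? [|? []]]]]]]]].
have ts : two_step_nilpotent g.
  split=> // x y z; have /centerP yz : lie y z \in center g.
    by rewrite cE; apply: spanE => i hi; apply: cl.
  by rewrite lieN yz oppr0.
split=> //; last exact: not_coclosed_center2 fe cE ts.
by apply: indecomposable_center2; rewrite // cE (eqP fe).
Qed.

Lemma exceptional_27A : is_27A g ->
  [/\ indecomposable g, two_step_nilpotent g & ~ admits_purely_coclosed_G2 g].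
Proof.
move=> [e be se].
have c6 x y : cc e 6 (lie x y) = - minor e 1 2 x y.
  by rewrite (structure_lie x y (Ordinal (isT : 5 < 7)%N) se) (tnth_nth 0) /= dual2_minor.
have c7 x y : cc e 7 (lie x y) = - (minor e 1 4 x y + minor e 3 5 x y).
  by rewrite (structure_lie x y (Ordinal (isT : 6 < 7)%N) se) (tnth_nth 0) /= fctE !dual2_minor.
have c5 i x y : (0 < i <= 5)%N -> cc e i (lie x y) = 0.
  case: i => // i hi; have hi7 : (i < 7)%N by apply: leq_trans hi _.
  rewrite (structure_lie x y (Ordinal hi7) se) (tnth_nth 0) /=.
  by case: i hi {hi7} => [|[|[|[|[|i]]]]] // _; exact: oppr0.
have ccb i j : (0 < i <= 7)%N -> (j < 7)%N -> cc e i e`_j = (i == j.+1)%:R by exact: cc_basis.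
apply: (not_coclosed_center_last_two be c5).
- move=> x; apply: (cc_eq0 be) => i /andP[i0 i7].
  have [i5|i5] := leqP i 5; first by rewrite c5 ?i0.
  have [->|->] : i = 6%N \/ i = 7%N by lia.
    by rewrite c6 /minor !ccb //=; ring.
  by rewrite c7 /minor !ccb //=; ring.
- move=> x; apply: (cc_eq0 be) => i /andP[i0 i7].
  have [i5|i5] := leqP i 5; first by rewrite c5 ?i0.
  have [->|->] : i = 6%N \/ i = 7%N by lia.
    by rewrite c6 /minor !ccb //=; ring.
  by rewrite c7 /minor !ccb //=; ring.
- move=> i x xc; have x6 j := c6 x e`_j; have x7 j := c7 x e`_j.
  (* These five brackets with basis vectors read off, up to sign, the coordinates 2, 1, 4, 5, 3 of
     x. *)
  move: (x6 0%N) (x6 1%N) (x7 0%N) (x7 2%N) (x7 4%N).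
  rewrite !xc !cc0 /minor !ccb //= => E1 E2 E3 E4 E5.
  by case: i => [|[|[|[|[|[|i]]]]]] // _; lra.
exists e`_0, e`_1 => E; have := c6 e`_0 e`_1.
by rewrite E cc0 /minor !ccb //=; lra.
Qed.

Lemma exceptional_27B : is_27B g ->
  [/\ indecomposable g, two_step_nilpotent g & ~ admits_purely_coclosed_G2 g].
Proof.
move=> [e be se].
have c6 x y : cc e 6 (lie x y) = - (minor e 1 2 x y + minor e 3 4 x y).
  by rewrite (structure_lie x y (Ordinal (isT : 5 < 7)%N) se) (tnth_nth 0) /= fctE !dual2_minor.
have c7 x y : cc e 7 (lie x y) = - (minor e 1 5 x y + minor e 2 3 x y).
  by rewrite (structure_lie x y (Ordinal (isT : 6 < 7)%N) se) (tnth_nth 0) /= fctE !dual2_minor.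
have c5 i x y : (0 < i <= 5)%N -> cc e i (lie x y) = 0.
  case: i => // i hi; have hi7 : (i < 7)%N by apply: leq_trans hi _.
  rewrite (structure_lie x y (Ordinal hi7) se) (tnth_nth 0) /=.
  by case: i hi {hi7} => [|[|[|[|[|i]]]]] // _; exact: oppr0.
have ccb i j : (0 < i <= 7)%N -> (j < 7)%N -> cc e i e`_j = (i == j.+1)%:R by exact: cc_basis.
apply: (not_coclosed_center_last_two be c5).
- move=> x; apply: (cc_eq0 be) => i /andP[i0 i7].
  have [i5|i5] := leqP i 5; first by rewrite c5 ?i0.
  have [->|->] : i = 6%N \/ i = 7%N by lia.
    by rewrite c6 /minor !ccb //=; ring.
  by rewrite c7 /minor !ccb //=; ring.
- move=> x; apply: (cc_eq0 be) => i /andP[i0 i7].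
  have [i5|i5] := leqP i 5; first by rewrite c5 ?i0.
  have [->|->] : i = 6%N \/ i = 7%N by lia.
    by rewrite c6 /minor !ccb //=; ring.
  by rewrite c7 /minor !ccb //=; ring.
- move=> i x xc; have x6 j := c6 x e`_j; have x7 j := c7 x e`_j.
  move: (x6 0%N) (x6 1%N) (x6 2%N) (x6 3%N) (x7 0%N).
  rewrite !xc !cc0 /minor !ccb //= => E1 E2 E3 E4 E5.
  by case: i => [|[|[|[|[|[|i]]]]]] // _; lra.
exists e`_0, e`_1 => E; have := c6 e`_0 e`_1.
by rewrite E cc0 /minor !ccb //=; lra.
Qed.

End Exceptional.

(** * Models of 27A and 27B *)

Section Models.
Variable R : realType.

(* b = false gives 27A, b = true gives 27B; coordinates are 0-based. *)
Definition bracket27 (b : bool) (x y : 'rV[R]_7) : 'rV[R]_7 :=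
  let m i j := x 0 (inord i) * y 0 (inord j) - x 0 (inord j) * y 0 (inord i) in
  \row_(k < 7)
    (if k == 5%N :> nat then - (if b then m 0%N 1%N + m 2%N 3%N else m 0%N 1%N)
     else if k == 6%N :> nat then
       - (if b then m 0%N 4%N + m 1%N 2%N else m 0%N 3%N + m 2%N 4%N)
     else 0).

Lemma bracket27_0 b x y i : (i < 5)%N -> bracket27 b x y 0 (inord i) = 0.
Proof.
move=> i5; rewrite mxE inordK; last by apply: leq_trans i5 _.
by case: i i5 => [|[|[|[|[|i]]]]].
Qed.

Lemma bracket27_linearr b x : linear (bracket27 b x).
Proof.
move=> a y z; apply/rowP=> k; rewrite !mxE.
by case: ifP => _; [|case: ifP => _]; case: b; ring.
Qed.

Lemma bracket27_linearl b z : linear (fun x => bracket27 b x z).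
Proof.
move=> a x y; apply/rowP=> k; rewrite !mxE.
by case: ifP => _; [|case: ifP => _]; case: b; ring.
Qed.

Lemma bracket27xx b x : bracket27 b x x = 0.
Proof.
apply/rowP=> k; rewrite !mxE.
by case: ifP => _; [|case: ifP => _]; case: b; ring.
Qed.

(** A bracket has only its last two coordinates nonzero, and [bracket27] reads only the first
    five. *)
Lemma bracket27_nil b x y z : bracket27 b x (bracket27 b y z) = 0.
Proof.
apply/rowP=> k; rewrite [LHS]mxE !bracket27_0 // mxE.
by case: ifP => _; [|case: ifP => _]; case: b; ring.
Qed.

Lemma bracket27_jacobi b x y z :
  bracket27 b x (bracket27 b y z) + bracket27 b y (bracket27 b z x) +
  bracket27 b z (bracket27 b x y) = 0.
Proof. by rewrite !bracket27_nil !addr0. Qed.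

End Models.

(** The phantom parameter [b] lets the same row vectors carry two different Lie algebra
    structures. *)
Definition model27 (R : realType) (b : bool) : Type := 'rV[R]_7.

HB.instance Definition _ (R : realType) (b : bool) :=
  Vector.on (model27 R b).
HB.instance Definition _ (R : realType) (b : bool) :=
  isLieAlgebra.Build R (model27 R b) (@bracket27_linearl R b)
    (@bracket27_linearr R b) (@bracket27xx R b) (@bracket27_jacobi R b).

Section ModelBasis.
Variables (R : realType) (b : bool).

Definition unit_vec (i : nat) : model27 R b := delta_mx 0 (inord i).

Lemma dim_model27 : \dim {: model27 R b} = 7%N.
Proof. by rewrite dimvf /dim /= mul1n. Qed.

Lemma unit_vecE i j : (i < 7)%N -> (j < 7)%N ->
  (unit_vec i : 'rV[R]_7) 0 (inord j) = (j == i)%:R.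
Proof. by move=> hi hj; rewrite mxE eqxx /= -val_eqE /= !inordK. Qed.

Lemma free_unit_vec : free [:: unit_vec 5; unit_vec 6].
Proof.
apply: free2P => s t /rowP E.
have := E (inord 5); have := E (inord 6); rewrite !mxE -!val_eqE /= !inordK //=.
by move=> E1 E2; split; lra.
Qed.

Lemma lie_unit_vec i j : (i < 7)%N -> (j < 7)%N ->
  let m k l := ((k == i) && (l == j))%:R - ((l == i) && (k == j))%:R : R in
  lie (unit_vec i) (unit_vec j) =
  - (if b then m 0%N 1%N + m 2%N 3%N else m 0%N 1%N) *: unit_vec 5
  - (if b then m 0%N 4%N + m 1%N 2%N else m 0%N 3%N + m 2%N 4%N) *: unit_vec 6.
Proof.
move=> hi hj m; apply/rowP=> k; rewrite [LHS]mxE !unit_vecE // !mxE !eqxx /=.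
rewrite -!val_eqE /= !inordK // /m -!mulnb !natrM.
by case: (nat_of_ord k) => [|[|[|[|[|[|[|k']]]]]]] /=; case: b; ring.
Qed.

Lemma unit_vec_central i x : (5 <= i < 7)%N -> lie (unit_vec i) x = 0.
Proof.
move=> /andP[i5 i7]; apply/rowP=> k; rewrite [LHS]mxE !unit_vecE // mxE.
by case: i i5 i7 => [|[|[|[|[|[|[|i]]]]]]] //= _ _;
  case: ifP => _; [|case: ifP => _| |case: ifP => _]; case: b; ring.
Qed.

End ModelBasis.

Lemma model27A (R : realType) : is_27A (model27 R false).
Proof.
pose v i : model27 R false := unit_vec R false i.
apply: (@is_27A_brackets _ _ (v 0%N) (v 1%N) (v 2%N) (v 3%N) (v 4%N) (v 5%N) (v 6%N));
  rewrite ?dim_model27 ?free_unit_vec //; try by [move=> x; apply: unit_vec_central];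
  rewrite lie_unit_vec //=
    ?(subr0, sub0r, subrr, oppr0, addr0, add0r, scale0r, scale1r, scaleN1r) //.
Qed.

Lemma model27B (R : realType) : is_27B (model27 R true).
Proof.
pose v i : model27 R true := unit_vec R true i.
apply: (@is_27B_brackets _ _ (v 0%N) (v 1%N) (v 2%N) (v 3%N) (v 4%N) (v 5%N) (v 6%N));
  rewrite ?dim_model27 ?free_unit_vec //; try by [move=> x; apply: unit_vec_central];
  rewrite lie_unit_vec //=
    ?(subr0, sub0r, subrr, oppr0, addr0, add0r, scale0r, scale1r, scaleN1r) //.
Qed.

Theorem theorem6p5 (R : realType) :
  [/\ forall g : lieAlgebraType R,
        \dim {:g} = 7%N -> indecomposable g -> two_step_nilpotent g ->
        ~ is_27A g -> ~ is_27B g -> admits_purely_coclosed_G2 g,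
      forall g : lieAlgebraType R, is_27A g \/ is_27B g ->
        [/\ indecomposable g, two_step_nilpotent g &
            ~ admits_purely_coclosed_G2 g],
      exists g : lieAlgebraType R, is_27A g &
      exists g : lieAlgebraType R, is_27B g].
Proof.
split.
- exact: admits_not_27AB.
- by move=> g [/exceptional_27A|/exceptional_27B].
- by exists (model27 R false); apply: model27A.
- by exists (model27 R true); apply: model27B.
Qed.
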